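(* Let $\pi$ be a finite non-increasing sequence of positive integers. Then $\pi$ is the degree sequence of some pseudoline arrangement graph if and only if both of the following hold: (1) $\pi = \langle 4^{d_4}, 3^{d_3}, 2^{d_2}\rangle$, where $3 \le d_2 \le n$, $d_3 = 2(n-d_2)$ and $d_4 = n(n-5)/2 + d_2$, for some integer $n \ge 3$; (2) if $d_2 = n$, then $n$ is odd.
   Context: A pseudoline is a curve in the Euclidean plane $\mathbb{R}^2$ approaching a point at infinity in both directions (equivalently, the image of a line under a homeomorphism of the plane). A simple pseudoline arrangement is a finite collection $L$ of at least three pseudolines such that every two of them cross exactly once and no three pass through a common point. Its pseudoline arrangement graph has as vertices the intersection points of pairs of pseudolines of $L$, with two vertices adjacent if they lie on a common pseudoline $l \in L$ and no other vertex lies on the part of $l$ between them. The degree sequence of a graph is the non-increasing list of its vertex degrees. The notation $\langle a^d\rangle$ denotes the sequence $a, a, \ldots, a$ of length $d$, and $\langle 4^{d_4},3^{d_3},2^{d_2}\rangle$ is the concatenation of such sequences. *)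

(* Defs.v *)
From mathcomp Require Import all_boot all_order all_algebra.
From mathcomp Require Import finmap.
From mathcomp Require Import all_classical all_reals all_analysis.

Set Implicit Arguments.
Unset Strict Implicit.
Unset Printing Implicit Defensive.

Import Order.TTheory GRing.Theory Num.Theory.
Import numFieldNormedType.Exports.
Local Open Scope classical_set_scope.
Local Open Scope ring_scope.

Notation plane R := (R * R)%type (only parsing).

Definition homeomorphism (T : topologicalType) (h : T -> T) : Prop :=
  exists g : T -> T,
    [/\ cancel h g, cancel g h, continuous h & continuous g].

Definition line_point (R : realType) (p d : plane R) (t : R) : plane R :=
  (p.1 + t * d.1, p.2 + t * d.2).

Definition pseudoline_param (R : realType) (g : R -> plane R) : Prop :=
  exists (h : plane R -> plane R) (p d : plane R),
    [/\ homeomorphism h, d != (0, 0) & g = h \o line_point p d].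

Definition pseudoline (R : realType) (l : set (plane R)) : Prop :=
  exists2 g, pseudoline_param g & l = range g.

(* The open arc of [l] with ends [u] and [v].  It does not depend on the
   parametrization: any two of them differ by a monotone bijection of [R]. *)
Definition part_between (R : realType) (l : set (plane R)) (u v : plane R) :
    set (plane R) :=
  [set w | exists g : R -> plane R, [/\ pseudoline_param g, l = range g &
     exists a b c : R,
       [/\ a < b, b < c, g a = u, g b = w & g c = v]]].

(* The two curves have exactly one common point, and there [l'] passes from one
   side of [l] to the other; the sides of [l] are the connected components of
   its complement.  Without the second condition the curves might only touch. *)
Definition cross_once (R : realType) (l l' : set (plane R)) : Prop :=
  (exists p, l `&` l' = [set p]) /\
  (exists u v, [/\ (l' `\` l) u, (l' `\` l) v &
                   ~ connected_component (~` l) u v]).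

(* Members with different indices are different sets, as they share one point
   only, so that [n] is the number of pseudolines. *)
Definition simple_arrangement (R : realType) (n : nat)
    (L : 'I_n -> set (plane R)) : Prop :=
  [/\ (3 <= n)%N,
      forall i, pseudoline (L i),
      forall i j, i != j -> cross_once (L i) (L j) &
      forall i j k, i != j -> i != k -> j != k ->
        L i `&` L j `&` L k = set0].

Definition arr_vertices (R : realType) (n : nat) (L : 'I_n -> set (plane R)) :
    set (plane R) :=
  [set v | exists i j, [/\ i != j, L i v & L j v]].

Definition arr_adj (R : realType) (n : nat) (L : 'I_n -> set (plane R))
    (u v : plane R) : Prop :=
  [/\ arr_vertices L u, arr_vertices L v, u <> v &
      exists i, [/\ L i u, L i v &
                    part_between (L i) u v `&` arr_vertices L = set0]].

(* Graphs with vertex set [V] and adjacency [adj].  [fset_set] is meaningful on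
   finite sets only; the graph of an arrangement is finite. *)
Definition degree (T : choiceType) (V : set T) (adj : T -> T -> Prop) (v : T) :
    nat :=
  #|` fset_set [set u | V u /\ adj v u]|.

Definition degree_sequence (T : choiceType) (V : set T)
    (adj : T -> T -> Prop) : seq nat :=
  sort geq [seq degree V adj v | v <- enum_fset (fset_set V)].

Definition is_arrangement_degree_sequence (R : realType) (s : seq nat) : Prop :=
  exists (n : nat) (L : 'I_n -> set (plane R)),
    simple_arrangement L /\ degree_sequence (arr_vertices L) (arr_adj L) = s.

(* Main.v *)
Require Import Defs.
From mathcomp Require Import all_boot all_order all_algebra.
From mathcomp Require Import finmap.
From mathcomp Require Import all_classical all_reals all_analysis.
From mathcomp Require Import zify ring lra.

(** Every pseudoline has two ends, and a crossing has degree 4 minus the number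
    of ends on which it is the last crossing; so everything but the bounds on
    [d2] and its parity is double counting, and [d2] is the number of wedges:
    crossings that are last on an end of both of their lines.

    To control wedges, record for each line the order of its crossings and the
    side of every other line on which each of its ends lies.  A crossing of two
    lines lies on the same side of a third line whichever of the two it is read
    from, and all the planar input needed follows from this symmetry.  Each
    closed side of a line contains a wedge, by a descent through shrinking
    sectors; no end lies in the sector opposite to a wedge; hence there are
    three wedges.  If all ends are in wedges, some line has both of its wedges
    on the same side, and the wedges on its other side pair up the remaining
    [n - 1] lines.

    Conversely, the lines [y = - x X + b x] for [x < n] cross at the slopes of
    the chords of the points [(x, b x)].  A zigzag makes all chords across a
    change of level extreme at both ends, and a slight bend, concave or convex,
    decides whether the outermost chord is. *)

Set Implicit Arguments.
Unset Strict Implicit.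
Unset Printing Implicit Defensive.

Import Order.TTheory GRing.Theory Num.Theory.
Import numFieldNormedType.Exports.
Local Open Scope ring_scope.

(** * Combinatorics of crossings and sides *)

Lemma odd_card_involution (T : finType) (f : T -> T) (A : {set T}) :
    (forall x, x \in A -> [/\ f x \in A, f x != x & f (f x) = x]) -> ~~ odd #|A|.
Proof.
elim: {A}_.+1 {-2}A (ltnSn #|A|) => // m IH A Am fA.
have [->|[x xA]] := set_0Vmem A; first by rewrite cards0.
have [fxA fxx ffx] := fA _ xA.
have cA : #|A| = (#|A :\ x :\ f x|).+2.
  by rewrite (cardsD1 x) xA (cardsD1 (f x)) !inE fxx fxA.
rewrite cA /= negbK; apply: IH; first by rewrite cA in Am; lia.
move=> y; rewrite !inE => /and3P[yfx yx yA]; have [fyA fyy ffy] := fA _ yA.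
split => //; rewrite fyA andbT; apply/andP; split.
  by apply: contra yx => /eqP e; rewrite -ffy e ffx.
by apply: contra yfx => /eqP e; rewrite -ffy e.
Qed.

Lemma card_setIdE (T : finType) (A : {set T}) (P : pred T) :
  #|[set x in A | P x]| = (\sum_(x in A) P x)%N.
Proof.
by rewrite -sum1dep_card big_mkcondr /=; apply: eq_bigr => x _; case: (P x).
Qed.

Section Beyond.
Variable R : realDomainType.
Implicit Types (c : bool) (x y z : R).

(** The order on a line read towards its end [c]; keeping the end as a Boolean lets one argument
    serve both ends. *)
Definition beyond c x y := if c then x < y else y < x.

Lemma beyond_trans c y x z : beyond c x y -> beyond c y z -> beyond c x z.
Proof. by case: c => /= xy yz; [apply: lt_trans yz|apply: lt_trans xy]. Qed.

Lemma beyond_irr c x : beyond c x x = false.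
Proof. by case: c; rewrite /= ltxx. Qed.

Lemma beyond_asym c x y : beyond c x y -> beyond c y x = false.
Proof. by case: c => /= xy; apply/negbTE; rewrite -leNgt ltW. Qed.

Lemma beyondN c x y : x != y -> ~~ beyond c x y -> beyond c y x.
Proof. by case: c => /=; case: ltgtP. Qed.

Lemma beyond_neg c x y : beyond (~~ c) x y = beyond c y x.
Proof. by case: c. Qed.

Lemma beyond_max (T : finType) c (f : T -> R) (A : {set T}) :
  A != finset.set0 -> {in A &, injective f} ->
  exists2 x : T, x \in A & forall y : T, y \in A -> y != x -> beyond c (f y) (f x).
Proof.
elim: {A}_.+1 {-2}A (ltnSn #|A|) => // m IH A Am /set0Pn[x xA] fI.
have [A0|A0] := eqVneq (A :\ x) finset.set0.
  by exists x => // y yA yx; move/setP/(_ y): A0; rewrite !inE yx yA.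
have [||y yA My] := IH (A :\ x) _ A0.
- by move: Am; rewrite (cardsD1 x) xA; lia.
- by move=> u v /setD1P[_ uA] /setD1P[_ vA]; apply: fI.
have [yx yA'] := setD1P yA.
have [Hxy|Hxy] := boolP (beyond c (f x) (f y)).
  exists y => // z zA zy; have [->//|zx] := eqVneq z x.
  by apply: My => //; rewrite !inE zx.
exists x => // z zA zx; have Hyx : beyond c (f y) (f x).
  by apply: beyondN Hxy; apply: contra yx => /eqP/fI ->.
have [->//|zy] := eqVneq z y.
by apply: beyond_trans Hyx; apply: My => //; rewrite !inE zx.
Qed.

End Beyond.

(** * Double counting of last crossings *)

Section Positions.
Variables (R : realDomainType) (n : nat) (t : 'I_n -> 'I_n -> R).
Hypothesis t_inj : forall i j k, j != i -> k != i -> t i j = t i k -> j = k.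

(* [t i j] is the position on line [i] of its crossing with [j]; [c] selects the
   end [+oo] or [-oo] of [i]. *)
Definition extreme i c j :=
  (j != i) && [forall k, (k != i) ==> (k != j) ==> beyond c (t i k) (t i j)].

Definition end_vertex i j := extreme i true j || extreme i false j.

Definition vertex_pairs : {set 'I_n * 'I_n} := [set p : 'I_n * 'I_n | (p.1 < p.2)%N].

Definition wedges :=
  [set p in vertex_pairs | end_vertex p.1 p.2 && end_vertex p.2 p.1].

(** These become the vertices of degree 3, as wedges become those of degree 2. *)
Definition half_wedges :=
  [set p in vertex_pairs | end_vertex p.1 p.2 (+) end_vertex p.2 p.1].

(** The next crossing after [j] towards the end [c], as a set with at most one element, empty when
    [j] is last. *)
Definition successors i c j :=
  [set l | [&& l != i, beyond c (t i j) (t i l) &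
     [forall m, (m != i) ==> ~~ (beyond c (t i j) (t i m) && beyond c (t i m) (t i l))]]].

Lemma extremeP i c j :
  reflect (j != i /\ forall k, k != i -> k != j -> beyond c (t i k) (t i j))
          (extreme i c j).
Proof.
apply: (iffP andP) => -[ji H]; split=> //.
  by move=> k ki kj; have := forallP H k; rewrite ki kj.
by apply/forallP => k; apply/implyP => ki; apply/implyP; apply: H.
Qed.

Lemma extreme_ex i c : (1 < n)%N -> exists j, extreme i c j.
Proof.
move=> n1; have A0 : [set~ i] != finset.set0 by rewrite -card_gt0 cardsC1 card_ord; lia.
have [|j] := @beyond_max R _ c (t i) [set~ i] A0.
  by move=> u v /[!inE]; apply: t_inj.
rewrite !inE => ji H; exists j; apply/extremeP; split=> // k ki kj.
by apply: H => //; rewrite !inE.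
Qed.

Lemma extreme_uniq i c j k : extreme i c j -> extreme i c k -> j = k.
Proof.
move=> /extremeP[ji Hj] /extremeP[ki Hk]; apply/eqP; apply: contraT => jk.
by have := Hj k ki; rewrite eq_sym jk (beyond_asym (Hk j ji jk)) => /(_ isT).
Qed.

Lemma third (i j : 'I_n) : (2 < n)%N -> exists2 k, k != i & k != j.
Proof.
move=> n2; have : (0 < #|~: [set i; j]|)%N.
  have := cardsC [set i; j]; rewrite card_ord cards2; case: (i != j) => /=; lia.
by case/card_gt0P => k; rewrite !inE negb_or => /andP[]; exists k.
Qed.

(** A third crossing would have to precede this one in both directions. *)
Lemma extreme_one_end i c d j :
  (2 < n)%N -> extreme i c j -> extreme i d j -> c = d.
Proof.
move=> n2 /extremeP[ji Hc] /extremeP[_ Hd]; have [k ki kj] := third i j n2.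
have [//|cd] := eqVneq c d; have {}cd : d = ~~ c by case: c d cd {Hc Hd} => -[].
have := Hd k ki kj; rewrite cd beyond_neg => H.
by have := beyond_asym (Hc k ki kj); rewrite H.
Qed.

Lemma card_end_vertex i : (2 < n)%N -> #|[set j | end_vertex i j]| = 2%N.
Proof.
move=> n2; have n1 : (1 < n)%N by lia.
have [j Hj] := extreme_ex i true n1; have [k Hk] := extreme_ex i false n1.
have jk : j != k.
  by apply/eqP => e; rewrite -e in Hk; have := extreme_one_end n2 Hj Hk.
suff -> : [set j | end_vertex i j] = [set j; k] by rewrite cards2 jk.
apply/setP => l; rewrite !inE; apply/orP/orP => -[].
- by move=> H; left; rewrite (extreme_uniq H Hj).
- by move=> H; right; rewrite (extreme_uniq H Hk).
- by move=> /eqP ->; left.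
- by move=> /eqP ->; right.
Qed.

Lemma end_vertex_neq i j : end_vertex i j -> j != i.
Proof. by case/orP => /extremeP[]. Qed.

(** The two summands are the two orders of a pair, and over ordered pairs every line contributes its
    two ends. *)
Lemma sum_end_vertex : (2 < n)%N ->
  (\sum_(p in vertex_pairs) (end_vertex p.1 p.2 + end_vertex p.2 p.1) = n.*2)%N.
Proof.
move=> n2; rewrite big_split /=.
have -> : (\sum_(p in vertex_pairs) end_vertex p.2 p.1 =
           \sum_(p : 'I_n * 'I_n | (p.2 < p.1)%N) end_vertex p.1 p.2)%N.
  rewrite (reindex_inj (h := fun p => (p.2, p.1))) => [|[a b] [c d] [-> ->] //].
  by apply: eq_bigl => -[a b]; rewrite inE.
transitivity (\sum_(p : 'I_n * 'I_n) end_vertex p.1 p.2)%N.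
  rewrite [RHS](bigID (fun p : 'I_n * 'I_n => (p.1 < p.2)%N)) /=; congr addn.
    by apply: eq_bigl => p; rewrite inE.
  rewrite [RHS](bigID (fun p : 'I_n * 'I_n => (p.2 < p.1)%N)) /=.
  rewrite [X in (_ = _ + X)%N]big1 ?addn0.
    by apply: eq_bigl => p; case: ltngtP.
  move=> -[a b] /=; case: ltngtP => // /val_inj -> _.
  by case E: (end_vertex b b) => //; have := end_vertex_neq E; rewrite eqxx.
rewrite -(pair_bigA _ (fun i j => nat_of_bool (end_vertex i j))) /=.
rewrite (eq_bigr (fun=> 2%N)) ?sum_nat_const ?card_ord ?muln2 // => i _.
rewrite /= -[RHS](card_end_vertex i n2) -sum1dep_card [RHS]big_mkcond /=.
by apply: eq_bigr => j _; case: end_vertex.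
Qed.

(** Of the [2n] ends, a wedge absorbs two and a half wedge one. *)
Lemma card_half_wedges : (2 < n)%N ->
  (#|half_wedges| + #|wedges|.*2 = n.*2)%N.
Proof.
move=> n2; rewrite -(sum_end_vertex n2) !card_setIdE -mul2n big_distrr -big_split.
by apply: eq_bigr => p _ /=; do 2 case: end_vertex.
Qed.

Lemma card_successors i c j : j != i -> #|successors i c j| = ~~ extreme i c j.
Proof.
move=> ji; case: extremeP => [[_ H]|H] /=.
  apply/eqP; rewrite cards_eq0; apply/eqP/setP => l; rewrite !inE.
  apply/negP => /and3P[li jl _].
  have [e|lj] := eqVneq l j; first by rewrite e beyond_irr in jl.
  by have := beyond_asym (H l li lj); rewrite jl.
pose A := [set l | (l != i) && beyond c (t i j) (t i l)].
have A0 : A != finset.set0.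
  apply/eqP => /setP A0; apply: H; split=> // k ki kj.
  have := A0 k; rewrite !inE ki /= => /negbT/beyondN; apply.
  by apply: contra kj => /eqP/t_inj -> //.
have [|l] := @beyond_max R _ (~~ c) (t i) A A0.
  by move=> u v; rewrite !inE => /andP[ui _] /andP[vi _]; apply: t_inj.
rewrite !inE => /andP[li jl] Hl; suff -> : successors i c j = [set l] by rewrite cards1.
apply/setP => m; rewrite !inE; apply/and3P/eqP => [[mi jm /forallP Hm]|->{m}].
  apply/eqP; apply: contraT => ml; have := Hm l; rewrite li jl /=.
  by rewrite -beyond_neg Hl // !inE mi.
split=> //; apply/forallP => m; apply/implyP => mi; apply/negP => /andP[jm ml].
have [e|nml] := eqVneq m l; first by rewrite e beyond_irr in ml.
have : m \in A by rewrite !inE mi.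
by move/Hl/(_ nml); rewrite beyond_neg (beyond_asym ml).
Qed.

End Positions.

(** * Sides of lines and location of wedges *)

Section Sides.
Variables (R : realDomainType) (n : nat) (t : 'I_n -> 'I_n -> R).
Variable chi : 'I_n -> 'I_n -> bool.
Hypothesis t_inj : forall i j k, j != i -> k != i -> t i j = t i k -> j = k.

(* [chi i k] is the side of [k] on which the end [+oo] of [i] lies, so the end
   [-oo] lies on the other one.  The next two definitions read off the side of
   [k] containing the crossing of [i] and [j], respectively the end [c] of
   [i]. *)
Definition vertex_side k i j := (t i k < t i j) == chi i k.
Definition end_side k i c := c == chi i k.

Local Notation sg := vertex_side.
Local Notation sd := end_side.
Local Notation ext := (extreme t).

Hypothesis sgC : forall i j k, j != i -> k != i -> k != j -> sg k i j = sg k j i.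
Hypothesis n2 : (2 < n)%N.

Let n1 : (1 < n)%N. Proof. exact: ltnW. Qed.

Lemma end_side_of k i s : sd k i (s == chi i k) = s.
Proof. by rewrite /end_side; case: s; case: (chi i k). Qed.

(** The line [i] changes sides of [k] only at their crossing; this translates order along a line
    into sides. *)
Lemma beyond_side i j k c : j != i -> k != i -> k != j ->
  beyond c (t i k) (t i j) = (sg k i j == sd k i c).
Proof.
move=> ji ki kj; rewrite /sg /sd.
have : t i k != t i j by apply: contra kj => /eqP/t_inj ->.
by case: c => /=; case: ltgtP; case: (chi i k).
Qed.

(** Add the three symmetries of the triangle modulo 2: on each line the comparison of its two
    vertices occurs twice, in opposite directions, and the three reversals leave an odd total. *)
Lemma six_sides i j k : j != i -> k != i -> k != j ->
  chi i j (+) chi j i (+) (chi i k (+) chi k i) (+) (chi j k (+) chi k j).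
Proof.
move=> ji ki kj; have ij : i != j by rewrite eq_sym.
have ik : i != k by rewrite eq_sym.
have jk : j != k by rewrite eq_sym.
have := sgC ji ki kj; have := sgC kj ij ik; have := sgC ik jk ji; rewrite /sg.
have F (a b c : 'I_n) : b != a -> c != a -> b != c ->
    (t a b < t a c) = ~~ (t a c < t a b).
  move=> ba ca bc; rewrite -leNgt le_eqVlt.
  by case: eqP => // /(t_inj ba ca) /eqP; rewrite (negbTE bc).
rewrite (F j k i) // (F k i j) // (F i j k) //.
by do 3 case: (_ < _); case: (chi i j); case: (chi i k); case: (chi j i);
  case: (chi j k); case: (chi k i); case: (chi k j).
Qed.

(** On [y], one inequality puts [m] between [r] and [k], the other puts [k] between [r] and [m]. *)
Lemma not_mutually_between y k m r : k != y -> m != y -> r != y ->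
  m != k -> r != k -> r != m ->
  sg m y r != sg m y k -> sg k y r != sg k y m -> False.
Proof.
move=> ky my ry mk rk rm; rewrite /sg.
have : t y m != t y k by apply: contra mk => /eqP/t_inj ->.
have : t y r != t y k by apply: contra rk => /eqP/t_inj ->.
have : t y r != t y m by apply: contra rm => /eqP/t_inj ->.
case: (chi y m); case: (chi y k); case: (ltgtP (t y r) (t y m)) => //;
case: (ltgtP (t y r) (t y k)) => //; case: (ltgtP (t y m) (t y k)) => //; lra.
Qed.

(** Beyond their common vertex neither end meets [k], so both lie on the side of [k] containing that
    vertex. *)
Lemma wedge_side i c j d k : ext i c j -> ext j d i -> k != i -> k != j ->
  sd k i c = sd k j d.
Proof.
move=> /extremeP[ji Hi] /extremeP[ij Hj] ki kj.
have /eqP <- : sg k i j == sd k i c by rewrite -beyond_side //; apply: Hi.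
have /eqP <- : sg k j i == sd k j d by rewrite -beyond_side //; apply: Hj.
exact: sgC.
Qed.

Local Ltac ne := first [assumption | rewrite eq_sym; assumption].

Lemma beyond_sideN i j k c : j != i -> k != i -> k != j ->
  beyond c (t i j) (t i k) -> sg k i j != sd k i c.
Proof. by move=> ji ki kj H; rewrite -beyond_side // (beyond_asym H). Qed.

(* [u] is the end of [r] in the sector between the ends [c] of [k] and [d] of
   [m]: the line [r] enters it across [m]. *)
Lemma sector_end k m r c d u : m != k -> r != k -> r != m ->
  beyond c (t k r) (t k m) -> beyond d (t m k) (t m r) ->
  sd m r u = sd m k c ->
  beyond u (t r k) (t r m) /\ sd k r u = sd k m d.
Proof.
move=> mk rk rm Hk Hm Hu.
have Hr : beyond u (t r k) (t r m).
  apply: beyondN; first by apply: contra mk => /eqP/t_inj -> //; ne.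
  rewrite beyond_side; try ne.
  by rewrite Hu -sgC; try ne; apply: beyond_sideN => //; ne.
split=> //; move: Hr Hm; rewrite !beyond_side; try ne.
by move=> /eqP <- /eqP <-; apply: sgC; ne.
Qed.

(** The line [y] has a point in the sector, its crossing with [r], and misses the ray of [k]
    bounding it, so it crosses the bounding ray of [m]. *)
Lemma sector_entry k m r y c d u : m != k -> r != k -> r != m ->
  y != k -> y != m -> y != r ->
  beyond c (t k r) (t k m) -> beyond c (t k y) (t k m) ->
  beyond d (t m k) (t m r) -> sd m r u = sd m k c ->
  beyond u (t r m) (t r y) -> beyond d (t m k) (t m y).
Proof.
move=> mk rk rm yk ym yr Hkr Hky Hm Hu Hr.
have [Hr' Hd] := sector_end mk rk rm Hkr Hm Hu.
have /eqP E1 : sg m r y == sd m r u by rewrite -beyond_side //; ne.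
have /eqP E2 : sg k r y == sd k r u.
  by rewrite -beyond_side; try ne; apply: beyond_trans Hr.
have N1 : sg m k y != sd m k c by apply: beyond_sideN => //; ne.
apply: contraT => NH; have H : beyond d (t m y) (t m k).
  by apply: beyondN NH; apply: contra yk => /eqP/t_inj -> //; ne.
have N2 : sg k m y != sd k m d by apply: beyond_sideN => //; ne.
(* Otherwise [m] separates the crossings of [y] with [r] and [k], and [k] separates those with [r]
   and [m]. *)
exfalso; apply: (@not_mutually_between y k m r); try ne.
  by rewrite -sgC ?E1 ?Hu; try ne; rewrite (sgC (i := y)) 1?eq_sym; ne.
by rewrite -sgC ?E2 ?Hd; try ne; rewrite (sgC (i := y)) 1?eq_sym; ne.
Qed.

(** The line [i] itself belongs to both of its closed sides. *)
Definition in_closed_side i s k c := (k == i) || (sd i k c == s).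

(* Descent: if the last vertex on the end [c] of [k] is its crossing with [m],
   and that is not the last one on the end [d] of [m], pass to [m] and to the
   line through the last vertex there, which has an end in the same sector. *)
Lemma wedge_in_side i s : exists k c m d,
  [/\ ext k c m, ext m d k, in_closed_side i s k c & in_closed_side i s m d].
Proof.
pose N m d k := #|[set y | [&& y != m, y != k & beyond d (t m k) (t m y)]]|.
suff H N0 k c m d : (N m d k < N0)%N -> ext k c m ->
    in_closed_side i s k c -> in_closed_side i s m d -> exists k c m d,
  [/\ ext k c m, ext m d k, in_closed_side i s k c & in_closed_side i s m d].
  (* The descent starts from [i] itself and from the end, on the side [s], of the line [m] that it
     meets last. *)
  have [m im] := extreme_ex t_inj i true n1.
  apply: (H _ i true m (s == chi m i) (ltnSn _) im); first by rewrite /in_closed_side eqxx.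
  by rewrite /in_closed_side end_side_of eqxx orbT.
elim: N0 k c m d => // N0 IH k c m d NN0 Hkm ck dm.
have [Hmk|Hmk] := boolP (ext m d k); first by exists k, c, m, d.
have [r Hmr] := extreme_ex t_inj m d n1.
have rk : r != k by apply: contra Hmk => /eqP <-.
have /extremeP[mk Hk] := Hkm; have /extremeP[rm Hm] := Hmr.
have Hkr : beyond c (t k r) (t k m) by apply: Hk.
have Hmk' : beyond d (t m k) (t m r) by apply: Hm => //; ne.
pose u := sd m k c == chi r m.
have Hu : sd m r u = sd m k c by rewrite end_side_of.
have [Hr Hd] := sector_end mk rk rm Hkr Hmk' Hu.
have Q y : y != k -> y != m -> y != r ->
    beyond u (t r m) (t r y) -> beyond d (t m k) (t m y).
  by move=> yk ym yr; apply: (sector_entry mk rk rm yk ym yr Hkr _ Hmk' Hu); apply: Hk.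
apply: (IH m d r u _ Hmr dm).
  (* By [Q] the lines met by [r] beyond [m] were already counted on [m], and [r] itself is counted
     no longer. *)
  rewrite -ltnS; apply: leq_trans NN0; rewrite ltnS; apply: proper_card.
  apply/properP; split.
    apply/fintype.subsetP => y; rewrite !inE => /and3P[yr ym Hy].
    have yk : y != k by apply: contraL Hy => /eqP ->; rewrite (beyond_asym Hr).
    by rewrite ym yk Q.
  by exists r; rewrite !inE ?eqxx // rm rk Hmk'.
rewrite /in_closed_side; have [//|ri] := eqVneq r i.
have [e|ki] := eqVneq k i.
  by move: dm; rewrite -e /in_closed_side (negbTE mk) Hd.
have [e|mi] := eqVneq m i.
  by move: ck; rewrite -e /in_closed_side eq_sym (negbTE mk) Hu.
move: ck dm; rewrite /in_closed_side (negbTE ki) (negbTE mi) /= => /eqP Sk /eqP Sm.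
have E1 : sg i m k = s.
  have /eqP <- : sg i k m == s by rewrite -Sk -beyond_side; try ne; apply: Hk; ne.
  by apply: sgC; ne.
have Hi : beyond d (t m i) (t m k) by rewrite beyond_side ?E1 ?Sm //; ne.
have /eqP E2 : sg i m r == s.
  by rewrite -Sm -beyond_side; try ne; apply: beyond_trans Hmk'.
(* If the end [u] of [r] were on the other side of [i], then [r] would meet [i] beyond [m], and [Q]
   would place [i] beyond [k] on [m], against [Hi]. *)
apply: contraT => Si.
suff /(beyond_asym) : beyond d (t m k) (t m i) by rewrite Hi.
apply: Q; try ne; apply: beyondN.
  by apply: contra mi => /eqP/t_inj <- //; ne.
by rewrite beyond_side; try ne; rewrite -sgC; try ne; rewrite E2 eq_sym.
Qed.

(** The line [l] meets both lines of the wedge on the rays bounding the opposite sector, so it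
    traverses that sector and ends outside. Formally, [wedge_side] and [six_sides] leave no Boolean
    solution. *)
Lemma wedge_excludes_end i a j b l d : ext i a j -> ext j b i ->
  l != i -> l != j ->
  ~~ ((sd i l d == ~~ sd i j b) && (sd j l d == ~~ sd j i a)).
Proof.
move=> ij ji li lj; have := wedge_side ij ji li lj.
have /extremeP[ne_ij _] := ij; have := six_sides ne_ij li lj; rewrite /end_side.
by case: a {ij}; case: b {ji}; case: d; case: (chi i j); case: (chi i l);
  case: (chi j i); case: (chi j l); case: (chi l i); case: (chi l j).
Qed.

Lemma end_vertex_wedge i j : end_vertex t i j -> end_vertex t j i ->
  exists2 p, p \in wedges t & [set p.1; p.2] = [set i; j].
Proof.
move=> ij ji; have ne_ij := end_vertex_neq ij.
have [h|h] := ltnP i j; first by exists (i, j); rewrite // !inE h ij.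
exists (j, i); last by rewrite finset.setUC.
by rewrite !inE ji ij !andbT ltn_neqAle h andbT.
Qed.

Lemma end_vertex_ext i c j : ext i c j -> end_vertex t i j.
Proof. by case: c => H; rewrite /end_vertex H ?orbT. Qed.

Lemma wedges_ge3 : (3 <= #|wedges t|)%N.
Proof.
pose i0 : 'I_n := Ordinal n1.
have [i [a [j [b [ij ji _ _]]]]] := wedge_in_side i0 true.
(* The second and third wedges are sought across each of the two lines of the first. *)
have [k [c [l [d [kl lk kS lS]]]]] := wedge_in_side i (~~ sd i j b).
have [k' [c' [l' [d' [kl' lk' kS' lS']]]]] := wedge_in_side j (~~ sd j i a).
have [p pW pE] := end_vertex_wedge (end_vertex_ext ij) (end_vertex_ext ji).
have [q qW qE] := end_vertex_wedge (end_vertex_ext kl) (end_vertex_ext lk).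
have [r rW rE] := end_vertex_wedge (end_vertex_ext kl') (end_vertex_ext lk').
have [/extremeP[nji _] /extremeP[nij _]] := (ij, ji).
have [/extremeP[nlk _] /extremeP[nlk' _]] := (kl, kl').
have set2E (x y z w : 'I_n) : w != z -> [set x; y] = [set z; w] ->
    (z = x /\ w = y) \/ (z = y /\ w = x).
  move=> wz /setP E; have := E z; have := E w; rewrite !inE !eqxx ?orbT.
  by move=> /orP[]/eqP wE /orP[]/eqP zE;
    [move: wz; rewrite wE zE eqxx|right|left|move: wz; rewrite wE zE eqxx].
have flip (x y z : 'I_n) e e' : ext x e y -> ext x e' y -> sd z x e' = ~~ sd z x e -> False.
  by move=> H H'; rewrite (extreme_one_end n2 H H'); case: sd.
(* An equal wedge would use the same ends, yet the end of [j] was taken on the other side of [i]. *)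
have pq : p != q.
  apply/eqP => e; move: pE; rewrite e qE => /(set2E _ _ _ _ nji)[[? ?]|[? ?]]; subst k l.
    by move: lS; rewrite /in_closed_side (negbTE nji) => /eqP; apply: flip ji lk.
  by move: kS; rewrite /in_closed_side (negbTE nji) => /eqP; apply: flip ji kl.
have pr : p != r.
  apply/eqP => e; move: pE; rewrite e rE => /(set2E _ _ _ _ nji)[[? ?]|[? ?]]; subst k' l'.
    by move: kS'; rewrite /in_closed_side (negbTE nij) => /eqP; apply: flip ij kl'.
  by move: lS'; rewrite /in_closed_side (negbTE nij) => /eqP; apply: flip ij lk'.
(* If these two coincide, one of their lines is neither [i] nor [j] and has an end in the sector
   opposite to the first wedge. *)
have qr : q != r.
  apply/eqP => e; have E : [set k; l] = [set k'; l'] by rewrite -qE e rE.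
  have [x [e1 [xi xj S1 S2]]] : exists x e,
      [/\ x != i, x != j, in_closed_side i (~~ sd i j b) x e &
          in_closed_side j (~~ sd j i a) x e].
    have [S1 S2] : in_closed_side j (~~ sd j i a) k c /\ in_closed_side j (~~ sd j i a) l d.
      have [[? ?]|[? ?]] := set2E _ _ _ _ nlk' E; subst k' l'.
        by rewrite (extreme_one_end n2 kl kl') (extreme_one_end n2 lk lk').
      by rewrite (extreme_one_end n2 kl lk') (extreme_one_end n2 lk kl').
    have : (k \notin [set i; j]) || (l \notin [set i; j]).
      rewrite -negb_and; apply/negP => /andP[ki li].
      case/eqP: pq; apply/eqP.
      suff F : [set p.1; p.2] = [set q.1; q.2].
        move: pW qW; rewrite !inE => /andP[h1 _] /andP[h2 _].
        have nq : q.2 != q.1 by apply: contraTneq h2 => ->; rewrite ltnn.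
        have [[Ea Eb]|[Ea Eb]] := set2E _ _ _ _ nq F.
          by rewrite [p]surjective_pairing -Ea -Eb -surjective_pairing.
        by rewrite Ea Eb in h2; have := ltn_trans h1 h2; rewrite ltnn.
      rewrite pE qE; apply/esym/eqP; rewrite eqEcard !cards2 (eq_sym k) nlk (eq_sym i) nji andbT.
      by apply/fintype.subsetP => x /set2P[->|->].
    by case/orP; rewrite !inE negb_or => /andP[? ?]; [exists k, c|exists l, d].
  have := wedge_excludes_end e1 ij ji xi xj.
  by move: S1 S2; rewrite /in_closed_side (negbTE xi) (negbTE xj) => /= -> ->.
have <- : #|[set p; q; r]| = 3%N.
  by rewrite -finset.setUA cardsU1 !inE negb_or pq pr cards2 qr.
by apply/subset_leq_card/fintype.subsetP => x /finset.setUP[/set2P[]|/set1P] ->.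
Qed.

Lemma card_wedges_eq_odd : #|wedges t| = n -> odd n.
Proof.
move=> Wn.
(* With [n] wedges no half wedge is left, so being last is mutual. *)
have mutual i j : end_vertex t i j -> end_vertex t j i.
  move=> ij; have ne_ij := end_vertex_neq ij.
  have /cards0_eq/setP H0 : #|half_wedges t| = 0%N.
    by have := card_half_wedges t_inj n2; rewrite Wn; lia.
  have [h|h] := ltnP i j; first by have := H0 (i, j); rewrite !inE h ij /= => /negbFE.
  have h' : (j < i)%N by rewrite ltn_neqAle h andbT.
  by have := H0 (j, i); rewrite !inE h' ij /= addbT => /negbFE.
have {}mutual i c j : ext i c j -> exists d, ext j d i.
  by move=> /end_vertex_ext/mutual/orP[]; [exists true|exists false].
pose i : 'I_n := Ordinal n1.
have [j ij] := extreme_ex t_inj i true n1; have [k ik] := extreme_ex t_inj i false n1.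
have [b ji] := mutual _ _ _ ij; have [c ki] := mutual _ _ _ ik.
have [/extremeP[nji _] /extremeP[nki _]] := (ij, ik).
have nkj : k != j.
  by apply/eqP => e; rewrite e in ik; have := extreme_one_end n2 ij ik.
(* Both wedges on [i] lie on the same side of it, by the parity of the triangle [i], [j], [k]. *)
have S : sd i j b = sd i k c.
  have nij : i != j by rewrite eq_sym.
  have njk : j != k by rewrite eq_sym.
  have := wedge_side ij ji nki nkj; have := wedge_side ik ki nji njk.
  have := six_sides nji nki nkj; rewrite /end_side.
  by case: b {ji}; case: c {ki}; case: (chi i j); case: (chi i k);
    case: (chi j i); case: (chi j k); case: (chi k i); case: (chi k j).
(* On the other side [s] of [i], [e l] is the end of [l] lying there; [f l] will be the line it
   meets last. *)
pose s := ~~ sd i j b; pose e l := s == chi l i.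
have eE l : sd i l (e l) = s by exact: end_side_of.
have f_ex l : exists m, ext l (e l) m by exact: extreme_ex.
pose f l := xchoose (f_ex l).
have fP l : ext l (e l) (f l) by exact: (xchooseP (f_ex l)).
suff : ~~ odd #|[set~ i]| by rewrite cardsC1 card_ord; move: n1; clear; lia.
apply: (@odd_card_involution _ f) => l; rewrite !inE => li.
have [d fl] := mutual _ _ _ (fP l).
(* A wedge of [l] with [i] is one of the two on [i], and these use ends on the side opposite to
   [s]. *)
have fli : f l != i.
  apply/eqP => E; have le := fP l; rewrite E in fl le.
  have : sd i l (e l) = sd i j b.
    by case: d fl => H; [have El := extreme_uniq H ij|have El := extreme_uniq H ik];
      rewrite El in le *; [rewrite (extreme_one_end n2 le ji)|rewrite (extreme_one_end n2 le ki)].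
  by rewrite eE /s; case: (sd i j b).
split=> //; first by have /extremeP[] := fP l.
(* The end of [f l] in its wedge with [l] also lies on the side [s], so it is the one chosen by
   [e]. *)
suff E : e (f l) = d by have H := fP (f l); rewrite E in H; rewrite (extreme_uniq H fl).
have il : i != l by rewrite eq_sym.
have ifl : i != f l by rewrite eq_sym.
have := wedge_side (fP l) fl il ifl; rewrite eE => H.
by move: H; rewrite /e /end_side => ->; case: d {fl}; case: (chi (f l) i).
Qed.

End Sides.

(** * Pseudolines *)

Local Open Scope classical_set_scope.
Local Open Scope ring_scope.

Lemma continuous_affine (R : realType) (T : topologicalType)
    (k : T -> plane R) (a b c : R) : continuous k ->
  continuous (fun z => a * (k z).1 + b * (k z).2 + c).
Proof.
move=> ck z.
have c1 : (fun z => (k z).1) @ z --> (k z).1 by apply: cvg_comp (ck z) cvg_fst.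
have c2 : (fun z => (k z).2) @ z --> (k z).2 by apply: cvg_comp (ck z) cvg_snd.
by apply: cvgD; [apply: cvgD; apply: cvgM => //; apply: cvg_cst|apply: cvg_cst].
Qed.

Lemma continuous_line_point (R : realType) (p d : plane R) :
  continuous (line_point p d).
Proof.
move=> x; have c a b : (fun t : R => a + t * b) @ x --> a + x * b.
  by apply: cvgD; [apply: cvg_cst|apply: cvgM; [apply: cvg_id|apply: cvg_cst]].
exact: cvg_pair (c p.1 d.1) (c p.2 d.2).
Qed.

(** Pull back by the inverse homeomorphism [k]: [rho] is the coordinate along the straight line and
    [phi] its equation. Points where [phi] has the same sign are joined by the image of a
    segment. *)
Lemma pseudoline_paramP (R : realType) (g : R -> plane R) : pseudoline_param g ->
  exists rho phi : plane R -> R,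
    [/\ continuous g, continuous rho, continuous phi, cancel g rho &
      (forall z, range g z <-> phi z = 0) /\
      (forall u v, 0 < phi u * phi v -> connected_component (~` range g) u v)].
Proof.
case=> h [p [d [[k [hK kK ch ck]] d0 ->]]].
pose N := d.1 ^+ 2 + d.2 ^+ 2.
have N0 : N != 0.
  rewrite /N; apply: contra d0 => /eqP N0.
  have [d1 d2] : d.1 = 0 /\ d.2 = 0 by split; nra.
  by apply/eqP; rewrite [d]surjective_pairing d1 d2.
pose rho z := (d.1 / N) * (k z).1 + (d.2 / N) * (k z).2 - (p.1 * d.1 + p.2 * d.2) / N.
pose phi z := d.2 * (k z).1 + (- d.1) * (k z).2 + (p.2 * d.1 - p.1 * d.2).
have cg : continuous (h \o line_point p d).
  by move=> x; apply: cvg_comp (@continuous_line_point _ p d x) (ch _).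
have crho : continuous rho by apply: continuous_affine.
have cphi : continuous phi by apply: continuous_affine.
have rP z : range (h \o line_point p d) z <-> phi z = 0.
  split=> [[x _ <-]|phi0]; first by rewrite /phi /= hK /=; ring.
  exists (rho z) => //=; rewrite -[RHS]kK; congr h.
  move: phi0; rewrite /phi /rho /line_point; case: (k z) => a b /= E.
  congr pair.
    rewrite -[RHS]subr0 -(mulr0 (d.2 / N)) -E; rewrite /N in N0 *; field.
    exact: N0.
  rewrite -[RHS]addr0 -(mulr0 (d.1 / N)) -E; rewrite /N in N0 *; field.
  exact: N0.
exists rho, phi; split => //.
  by move=> x; rewrite /rho /= hK /=; rewrite /N in N0 *; field; exact: N0.
split=> // u v uv.
pose q (s : R) : plane R := line_point (k u) ((k v).1 - (k u).1, (k v).2 - (k u).2) s.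
have cq : continuous (h \o q).
  by move=> x; apply: cvg_comp (@continuous_line_point _ _ _ x) (ch _).
exists ((h \o q) @` `[0, 1]); last first.
  exists 1; first by rewrite /= in_itv /= ler01 lexx.
  rewrite /q /line_point /= -[RHS]kK; congr h; rewrite !mul1r.
  by rewrite [k v]surjective_pairing; congr pair; rewrite /= addrC subrK.
split.
- exists 0; first by rewrite /= in_itv /= ler01 lexx.
  rewrite /q /line_point /= -[RHS]kK; congr h; rewrite !mul0r !addr0.
  by rewrite -surjective_pairing.
- move=> _ [s /= s01 <-] /rP; move: s01; rewrite in_itv /= => /andP[s0 s1].
  have -> : phi (h (q s)) = (1 - s) * phi u + s * phi v.
    by rewrite /phi hK /q /line_point /=; ring.
  (* Multiplied by [phi v], both terms are nonnegative and cannot vanish together. *)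
  move=> E; have {}E : (1 - s) * (phi u * phi v) + s * (phi v * phi v) = 0.
    by rewrite -(mul0r (phi v)) -E; ring.
  have [s00|s0'] := eqVneq s 0; first by move: E; rewrite s00; lra.
  have sgt0 : 0 < s by rewrite lt_neqAle eq_sym s0'.
  have v0 : phi v != 0 by apply: contraTneq uv => ->; rewrite mulr0 ltxx.
  have : 0 < s * (phi v * phi v) by rewrite mulr_gt0 // -expr2 exprn_even_gt0.
  have : 0 <= (1 - s) * (phi u * phi v) by rewrite mulr_ge0 ?subr_ge0 // ltW.
  by lra.
- by apply: connected_continuous_connected;
    [exact: segment_connected|exact: continuous_subspaceT].
Qed.

Lemma nonzero_same_sign (R : realType) (f : R -> R) (x y : R) : continuous f ->
  x <= y -> (forall z, x <= z <= y -> f z != 0) -> (0 < f x) = (0 < f y).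
Proof.
move=> cf xy nz; apply: contrapT => neq.
have [||z] := @IVT R f x y 0 xy.
- exact: continuous_subspaceT.
- move: neq; rewrite ge_min le_max.
  by case: (ltgtP 0 (f x)) => //; case: (ltgtP 0 (f y)).
by rewrite in_itv /= => /nz /eqP.
Qed.

(** The intermediate value theorem fixes the sign on each side of [x0], and both signs occur. The
    Boolean [c] will record the side on which an end lies. *)
Lemma single_zero_sign_change (R : realType) (f : R -> R) (x0 a b : R) :
  continuous f -> (forall x, f x = 0 -> x = x0) -> f a < 0 -> 0 < f b ->
  exists c : bool, forall x, x != x0 -> (0 < f x) = ((x0 < x) == c).
Proof.
move=> cf f0 fa fb.
have R1 x y : x0 < x -> x0 < y -> (0 < f x) = (0 < f y).
  wlog xy : x y / x <= y.
    by move=> H; have [xy|/ltW xy] := leP x y => ? ?; [|apply/esym]; apply: H.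
  move=> hx _; apply: nonzero_same_sign => // z /andP[xz _].
  by apply/eqP => /f0 e; move: (lt_le_trans hx xz); rewrite e ltxx.
have R2 x y : x < x0 -> y < x0 -> (0 < f x) = (0 < f y).
  wlog xy : x y / x <= y.
    by move=> H; have [xy|/ltW xy] := leP x y => ? ?; [|apply/esym]; apply: H.
  move=> _ hy; apply: nonzero_same_sign => // z /andP[_ zy].
  by apply/eqP => /f0 e; move: (le_lt_trans zy hy); rewrite e ltxx.
have fx0 : f x0 = 0.
  have [xab|] := pselect (exists x, f x = 0); first by case: xab => x fx; rewrite -(f0 _ fx).
  move=> nx; have nz z : f z != 0 by apply/eqP => fz; apply: nx; exists z.
  have E : (0 < f a) = (0 < f b).
    have [ab|/ltW ab] := leP a b; last apply/esym; exact: nonzero_same_sign.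
  by move: E; rewrite fb; case: ltgtP fa.
have na : (0 < f a) = false by case: ltgtP fa.
exists (0 < f (x0 + 1)) => x; case: (ltgtP x0 x) => // hx _.
  by rewrite (R1 x (x0 + 1)) //; lra.
have [h1|h1|h1] := ltgtP x0 a; last by rewrite -h1 fx0 ltxx in fa.
  rewrite (R1 (x0 + 1) a) ?na; try lra.
  have [h2|h2|h2] := ltgtP x0 b; last by rewrite -h2 fx0 ltxx in fb.
    by move: (R1 a b h1 h2); rewrite na fb.
  by rewrite (R2 x b) // fb.
rewrite (R2 x a) // na.
have [h2|h2|h2] := ltgtP x0 b; last by rewrite -h2 fx0 ltxx in fb.
  by rewrite (R1 (x0 + 1) b) ?fb //; lra.
by move: (R2 a b h1 h2); rewrite na fb.
Qed.

Lemma pseudoline_param_opp (R : realType) (g : R -> plane R) :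
  pseudoline_param g -> pseudoline_param (g \o -%R).
Proof.
case=> h [p [d [hh d0 ->]]]; exists h, p, (- d.1, - d.2); split=> //.
  by apply: contra d0 => /eqP[/eqP]; rewrite !oppr_eq0 => /eqP d1 /eqP;
    rewrite oppr_eq0 => /eqP d2; rewrite [d]surjective_pairing d1 d2.
by apply/funext => x; rewrite /line_point /= !mulrN !mulNr.
Qed.

(** Another parametrization differs by [th], a continuous injection of the real line and hence
    monotone, so betweenness can be read on the fixed [g]. *)
Lemma part_betweenE (R : realType) (g : R -> plane R) (e : bool) (a b c : R) :
  pseudoline_param g -> beyond e a c ->
  part_between (range g) (g a) (g c) (g b) <-> beyond e a b && beyond e b c.
Proof.
move=> pg ac; split=> [|/andP[ab bc]]; last first.
  case: e ac ab bc => /= ac ab bc; first by exists g; split=> //; exists a, b, c.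
  exists (g \o -%R); split; first exact: pseudoline_param_opp.
    by apply/seteqP; split=> [_ [x _ <-]|_ [x _ <-]]; exists (- x); rewrite //= opprK.
  by exists (- a), (- b), (- c); split; rewrite /= ?opprK ?ltrN2.
case=> g' [pg' Egg' [a' [b' [c' [ab' bc' Ea Eb Ec]]]]].
have [rho [phi [cg crho _ gK _]]] := pseudoline_paramP pg.
have [rho' [phi' [cg' _ _ gK' _]]] := pseudoline_paramP pg'.
pose th := rho \o g'.
have gth x : g (th x) = g' x.
  have : range g (g' x) by rewrite Egg'; exists x.
  by case=> y _ E; rewrite /th /= -E gK.
have cth : continuous th by move=> x; apply: cvg_comp (cg' x) (crho _).
have ith : injective th by move=> x y E; apply: (can_inj gK'); rewrite -!gth E.
have -> : a = th a' by apply: (can_inj gK); rewrite gth Ea.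
have -> : b = th b' by apply: (can_inj gK); rewrite gth Eb.
have Ec' : c = th c' by apply: (can_inj gK); rewrite gth Ec.
have Ea' : a = th a' by apply: (can_inj gK); rewrite gth Ea.
move: ac; rewrite Ec' Ea'.
have ac' := lt_trans ab' bc'.
have := @itv_continuous_inj_mono R th `]-oo, +oo[ (continuous_subspaceT cth) (in2W ith).
have I (x : R) : x \in `]-oo, +oo[ by rewrite in_itv.
case=> H; have [h1 h2] := (H _ _ (I _) (I _) ab', H _ _ (I _) (I _) bc');
by case: e => /=; rewrite ?h1 ?h2 // ltNge ltW // (lt_trans _ h2, lt_trans h2).
Qed.

(** * The graph of an arrangement *)

Definition coordinates (R : realType) (n : nat) (L : 'I_n -> set (plane R))
    (g : 'I_n -> R -> plane R) (t : 'I_n -> 'I_n -> R) : Prop :=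
  [/\ forall i, pseudoline_param (g i), forall i, L i = range (g i) &
      forall i j, j != i -> L i `&` L j = [set g i (t i j)]].

Lemma coordinates_ex (R : realType) (n : nat) (L : 'I_n -> set (plane R)) :
  simple_arrangement L -> exists g t, coordinates L g t.
Proof.
case=> _ Lp Lc _.
have /choice[g gP] i : exists g, pseudoline_param g /\ L i = range g.
  by have [g ? ?] := Lp i; exists g.
have /choice[t tP] (ij : 'I_n * 'I_n) : exists x,
    ij.2 != ij.1 -> L ij.1 `&` L ij.2 = [set g ij.1 x].
  case: ij => i j /=; have [->|ji] := eqVneq j i; first by exists 0.
  have [|[p pE] _] := Lc i j; first by rewrite eq_sym.
  have [Lip _] : (L i `&` L j) p by rewrite pE.
  by move: Lip; rewrite {1}(gP i).2 => -[x _ xp]; exists x => _; rewrite pE xp.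
exists g, (fun i j => t (i, j)); split=> [i|i|i j ji]; [exact: (gP i).1|exact: (gP i).2|].
exact: (tP (i, j)).
Qed.

Lemma perm_fset_set (T : choiceType) (s : seq T) : uniq s ->
  perm_eq (enum_fset (fset_set [set` s])) s.
Proof.
move=> us; apply: uniq_perm => // x.
by rewrite -[_ \in enum_fset _]/(_ \in fset_set _) in_fset_set ?mem_setE.
Qed.

Lemma sort_geq_234 (s : seq nat) : all (mem [:: 2; 3; 4]%N) s ->
  sort geq s = nseq (count_mem 4%N s) 4%N ++ nseq (count_mem 3%N s) 3%N ++
               nseq (count_mem 2%N s) 2%N.
Proof.
move=> sP; apply: (@sorted_eq _ geq).
- by move=> a b c /= ba cb; apply: leq_trans ba.
- by move=> a b; rewrite /= andbC -eqn_leq => /eqP.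
- by apply: sort_sorted => a b; apply: leq_total.
- have P2 c : path geq 2%N (nseq c 2%N) by elim: c.
  have P3 b c : path geq 3%N (nseq b 3%N ++ nseq c 2%N).
    by elim: b => //=; case: c => //= c; rewrite P2.
  apply: (path_sorted (x := 4%N)); elim: (count_mem 4%N s) => //=.
  case: (count_mem 3%N s) => [|b] /=; last by rewrite P3.
  by case: (count_mem 2%N s) => //= c; rewrite P2.
rewrite perm_sort; apply/permP => a; rewrite !count_cat !count_nseq.
elim: s sP => [|x s IH] /=; first by rewrite !muln0.
by move=> /andP[]; rewrite !inE => /or3P[]/eqP -> /IH ->; rewrite /= !mulnDr ?muln1 ?muln0; lia.
Qed.

Lemma count_enum (T : finType) (A : {set T}) (P : pred T) :
  count P (enum A) = #|[set x in A | P x]|.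
Proof. by rewrite -sum1_count big_enum_cond sum1dep_card. Qed.

Lemma card_vertex_pairs n : (#|vertex_pairs n|.*2 + n = n * n)%N.
Proof.
have -> : (n * n = \sum_(p : 'I_n * 'I_n) 1)%N by rewrite sum1_card card_prod card_ord.
rewrite (bigID (fun p : 'I_n * 'I_n => (p.1 < p.2)%N)) /=.
rewrite [X in (_ = _ + X)%N](bigID (fun p : 'I_n * 'I_n => (p.2 < p.1)%N)) /=.
rewrite -addnn -addnA; congr addn; first by rewrite sum1dep_card.
congr addn.
  rewrite -sum1_card (reindex_inj (h := fun p => (p.2, p.1))) => [|[a b] [c d] [-> ->] //].
  by apply: eq_bigl => -[a b]; rewrite inE /=; case: ltngtP.
rewrite sum1dep_card -[LHS]card_ord -cardsT.
rewrite -(card_imset _ (f := fun i : 'I_n => (i, i))) => [|i j [] //].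
apply: eq_card => -[a b]; rewrite !inE /=; apply/imsetP/idP => [[i _ [-> ->]]|].
  by rewrite ltnn.
by rewrite -!leqNgt -eqn_leq => /eqP/val_inj ->; exists a.
Qed.

Section Coordinates.
Variables (R : realType) (n : nat) (L : 'I_n -> set (plane R)).
Variables (g : 'I_n -> R -> plane R) (t : 'I_n -> 'I_n -> R).
Hypothesis LA : simple_arrangement L.
Hypothesis gtP : coordinates L g t.

Definition crossing i j := g i (t i j).
Local Notation vt := crossing.

Let n2 : (2 < n)%N. Proof. by case: LA. Qed.

Lemma crossing_on i j : j != i -> L i (vt i j) /\ L j (vt i j).
Proof. by case: gtP => _ _ H ji; have [] : (L i `&` L j) (vt i j) by rewrite H. Qed.

Lemma crossing_uniq i j z : j != i -> L i z -> L j z -> z = vt i j.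
Proof. by case: gtP => _ _ H ji Li Lj; have : (L i `&` L j) z by []; rewrite H. Qed.

Lemma crossingC i j : j != i -> vt i j = vt j i.
Proof.
move=> ji; have [Li Lj] := crossing_on ji.
by apply: crossing_uniq => //; rewrite eq_sym.
Qed.

Lemma param_inj i : injective (g i).
Proof.
case: gtP => gp _ _; have [rho [_ [_ _ _ gK _]]] := pseudoline_paramP (gp i).
exact: can_inj gK.
Qed.

Lemma crossing_lines i j k : j != i -> L k (vt i j) -> k = i \/ k = j.
Proof.
move=> ji Lk; have [Li Lj] := crossing_on ji.
have [->|ki] := eqVneq k i; first by left.
have [->|kj] := eqVneq k j; first by right.
case: LA => _ _ _ /(_ i j k); rewrite eq_sym ji eq_sym ki eq_sym kj => /(_ isT isT isT) E.
by have : set0 (vt i j) by rewrite -E.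
Qed.

Lemma position_inj i j k : j != i -> k != i -> t i j = t i k -> j = k.
Proof.
move=> ji ki E; have [_ Lj] := crossing_on ji.
have : L j (vt i k) by rewrite /vt -E.
by case/(crossing_lines ki) => [e|//]; rewrite e eqxx in ji.
Qed.

(** A side of [k] is a sign of the function [phi k] vanishing exactly on it; at a crossing this sign
    depends on the point, not on the line along which it is reached. *)
Lemma sides_ex : exists chi, forall i j k, j != i -> k != i -> k != j ->
  vertex_side t chi k i j = vertex_side t chi k j i.
Proof.
case: (LA) => _ _ Lc _; case: (gtP) => gp LE LI.
have /choice[phi phiP] i : exists phi : plane R -> R,
  [/\ continuous phi, forall z, L i z <-> phi z = 0 &
    forall u v, 0 < phi u * phi v -> connected_component (~` L i) u v].
  have [_ [phi [_ _ cphi _ [H1 H2]]]] := pseudoline_paramP (gp i).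
  by exists phi; rewrite LE.
have /choice[chi chiP] (ik : 'I_n * 'I_n) : exists c : bool, ik.2 != ik.1 ->
    forall x, x != t ik.1 ik.2 -> (0 < phi ik.2 (g ik.1 x)) = ((t ik.1 ik.2 < x) == c).
  case: ik => i k /=; have [->|ki] := eqVneq k i; first by exists true.
  have [cphi phi0 phiC] := phiP k.
  (* Crossing rather than touching supplies points of [L i] where [phi k] has opposite signs. *)
  have [_ [u [v [[Lu ku] [Lv kv] uv]]]] := Lc k i ki.
  move: Lu Lv; rewrite LE => -[a _ aE] [b _ bE].
  have cf : continuous (phi k \o g i).
    have [_ [_ [cg _ _ _ _]]] := pseudoline_paramP (gp i).
    by move=> x; apply: cvg_comp (cg x) (cphi _).
  have f0 x : (phi k \o g i) x = 0 -> x = t i k.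
    move=> /phi0 Lx; apply: (@param_inj i); apply: crossing_uniq => //.
    by rewrite LE; exists x.
  have nu : phi k u != 0 by apply/eqP => /phi0.
  have nv : phi k v != 0 by apply/eqP => /phi0.
  have {}uv : ~~ (0 < phi k u * phi k v) by apply/negP => /phiC.
  have [u0|u0|u0] := ltgtP 0 (phi k u); last by rewrite -u0 eqxx in nu.
    have v0 : phi k v < 0.
      rewrite lt_neqAle nv /=; move: uv; rewrite -leNgt pmulr_rle0 //.
    have [||c cP] := @single_zero_sign_change R _ (t i k) b a cf f0;
      [by rewrite /= bE|by rewrite /= aE|by exists c].
  have v0 : 0 < phi k v.
    by rewrite lt_neqAle eq_sym nv /=; move: uv; rewrite -leNgt nmulr_rle0.
  have [||c cP] := @single_zero_sign_change R _ (t i k) a b cf f0;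
    [by rewrite /= aE|by rewrite /= bE|by exists c].
exists (fun i k => chi (i, k)) => i j k ji ki kj; rewrite /vertex_side.
rewrite -(chiP (i, k)) //=; last first.
  by apply: contra kj => /eqP/position_inj ->.
rewrite -(chiP (j, k)) //=; last first.
  by apply: contra ki => /eqP/position_inj -> //; rewrite eq_sym.
by rewrite -!/(vt _ _) crossingC.
Qed.

Lemma vertexP i z : L i z -> arr_vertices L z <-> exists2 l, l != i & z = vt i l.
Proof.
move=> Liz; split=> [[a [b [ab La Lb]]]|[l li ->]].
  have [e|ai] := eqVneq a i; last by exists a => //; apply: crossing_uniq.
  by exists b; [rewrite -e eq_sym|apply: crossing_uniq => //; rewrite -e eq_sym].
by have [? ?] := crossing_on li; exists i, l; rewrite eq_sym.
Qed.

Lemma consecutiveP i j l : j != i -> l != i ->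
  (vt i j <> vt i l /\ part_between (L i) (vt i j) (vt i l) `&` arr_vertices L = set0) <->
  exists c, l \in successors t i c j.
Proof.
case: (gtP) => gp LE _ ji li; split.
  move=> [/eqP ne]; have tne : t i j != t i l by apply: contra ne => /eqP e; rewrite /vt e.
  have [c jl] : exists c, beyond c (t i j) (t i l).
    by case: (ltgtP (t i j) (t i l)) tne => // h _; [exists true|exists false].
  move=> E; exists c; rewrite inE li jl /=; apply/forallP => m; apply/implyP => mi.
  apply/negP => /(part_betweenE (t i m) (gp i) jl) H.
  have : set0 (vt i m) by rewrite -E; split; rewrite ?LE //; apply/(vertexP _);
    [apply: (crossing_on mi).1|exists m].
  by [].
case=> c; rewrite inE => /and3P[_ jl /forallP H]; split.
  by move=> /param_inj e; rewrite e beyond_irr in jl.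
rewrite -subset0 => z [pz Vz].
have Lz : L i z.
  by case: pz => g' [_ -> [_ [b [_ [_ _ _ <- _]]]]]; exists b.
move/(vertexP Lz): Vz => [m mi zE]; move: pz; rewrite zE LE.
by move=> /(part_betweenE _ (gp i) jl); apply/negP; have := H m; rewrite mi.
Qed.

Definition neighbours i j := [seq vt i l | l in successors t i true j :|: successors t i false j].

Lemma arr_adjP i j z : j != i ->
  arr_adj L (vt i j) z <-> z \in neighbours i j ++ neighbours j i.
Proof.
move=> ji; have ij : i != j by rewrite eq_sym.
have NP a b w : b != a -> w \in neighbours a b <-> L a w /\ arr_vertices L w /\
   vt a b <> w /\ part_between (L a) (vt a b) w `&` arr_vertices L = set0.
  move=> ba; split.
    case/mapP => l; rewrite mem_enum inE => lS ->.
    have la : l != a by case/orP: lS; rewrite inE => /and3P[].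
    have Lal := (crossing_on la).1; split=> //; split; first by apply/(vertexP Lal); exists l.
    by apply/consecutiveP => //; case/orP: lS; [exists true|exists false].
  case=> Law [/(vertexP Law)[l la ->]] /(consecutiveP ba la)[c lc].
  by apply/mapP; exists l => //; rewrite mem_enum inE; case: c lc => ->; rewrite ?orbT.
have [Li Lj] := crossing_on ji; have Vv : arr_vertices L (vt i j).
  by apply/(vertexP Li); exists j.
rewrite mem_cat; split.
  case=> _ Vz vz [k [Lkv Lkz E]]; apply/orP.
  have [e|e] := crossing_lines ji Lkv; rewrite e in Lkz E.
    by left; apply/NP.
  by right; apply/NP => //; rewrite -crossingC.
case/orP => /NP; rewrite -?(crossingC ji); case=> // Lz [Vz [vz E]]; split=> //.
  by exists i.
by exists j.
Qed.

(** Two lines share only their crossing, so no neighbour is listed twice and the length of the list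
    is the degree. *)
Lemma uniq_neighbours i j : j != i -> uniq (neighbours i j ++ neighbours j i).
Proof.
move=> ji; have ij : i != j by rewrite eq_sym.
have U a b : b != a -> uniq (neighbours a b).
  move=> ba; rewrite map_inj_in_uniq ?enum_uniq // => l m.
  rewrite !mem_enum !inE => lS mS /param_inj; apply: position_inj.
    by case/orP: lS => /and3P[].
  by case/orP: mS => /and3P[].
rewrite cat_uniq !U //= andbT; apply/hasPn => z zj; apply/negP => zi.
have Lz a b : b != a -> z \in neighbours a b -> L a z /\ z <> vt a b.
  move=> ba /mapP[l]; rewrite mem_enum !inE => lS ->.
  have la : l != a by case/orP: lS => /and3P[].
  split; first by have [] := crossing_on la.
  by move=> /param_inj e; case/orP: lS => /and3P[_]; rewrite e beyond_irr.
have [Li ne] := Lz i j ji zi; have [Lj _] := Lz j i ij zj.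
by apply: ne; apply: crossing_uniq.
Qed.

(** Each direction has one neighbour unless the crossing is last there, which cannot happen in both
    directions. *)
Lemma size_neighbours i j : j != i ->
  (size (neighbours i j) + end_vertex t i j = 2)%N.
Proof.
move=> ji; rewrite size_map -cardE cardsU.
have -> : successors t i true j :&: successors t i false j = finset.set0.
  apply/setP => l; rewrite !inE; apply/negP => /andP[/and3P[_ h _] /and3P[_ h' _]].
  by move: h'; rewrite -[false]/(~~ true) beyond_neg (beyond_asym h).
rewrite cards0 subn0 !(card_successors position_inj) // /end_vertex.
case E1: (extreme t i true j); case E2: (extreme t i false j) => //.
by have := extreme_one_end n2 E1 E2.
Qed.

Lemma degree_crossing i j : j != i ->
  (degree (arr_vertices L) (arr_adj L) (vt i j) +
     (end_vertex t i j + end_vertex t j i) = 4)%N.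
Proof.
move=> ji; have ij : i != j by rewrite eq_sym.
have E : [set u | arr_vertices L u /\ arr_adj L (vt i j) u] =
         [set` neighbours i j ++ neighbours j i].
  apply/seteqP; split=> u /=; first by case=> _ /(arr_adjP _ ji).
  by move/(arr_adjP _ ji) => H; split=> //; case: H.
rewrite /degree E.
have /perm_size -> := perm_fset_set (uniq_neighbours ji).
by rewrite size_cat addnACA !size_neighbours.
Qed.

Definition crossings := [seq vt p.1 p.2 | p in vertex_pairs n].

Lemma uniq_crossings : uniq crossings.
Proof.
rewrite map_inj_in_uniq ?enum_uniq // => -[i j] [k l]; rewrite !mem_enum !inE /= => ij kl E.
have ji : j != i by rewrite neq_ltn ij orbT.
have lk : l != k by rewrite neq_ltn kl orbT.
have [Lk Ll] := crossing_on lk; rewrite -E in Lk Ll.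
have [ek|ek] := crossing_lines ji Lk; have [el|el] := crossing_lines ji Ll; subst k l => //.
- by rewrite eqxx in lk.
- by have := ltn_trans ij kl; rewrite ltnn.
- by rewrite eqxx in lk.
Qed.

Lemma arr_vertices_crossings : arr_vertices L = [set` crossings].
Proof.
apply/seteqP; split=> z /=.
  move=> [i [j [ij Li Lj]]]; have ji : j != i by rewrite eq_sym.
  apply/mapP; have [h|h] := ltnP i j.
    by exists (i, j); rewrite ?mem_enum ?inE //=; apply: crossing_uniq.
  exists (j, i); last exact: crossing_uniq.
  by rewrite mem_enum inE /= ltn_neqAle h andbT.
case/mapP => -[i j]; rewrite mem_enum inE /= => ij ->.
have ji : j != i by rewrite neq_ltn ij orbT.
by have [? ?] := crossing_on ji; exists i, j; rewrite eq_sym.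
Qed.

Lemma degree_sequenceE : exists d4,
  degree_sequence (arr_vertices L) (arr_adj L) =
    nseq d4 4%N ++ nseq #|half_wedges t| 3%N ++ nseq #|wedges t| 2%N /\
  (d4 + #|half_wedges t| + #|wedges t| = #|vertex_pairs n|)%N.
Proof.
set e := fun p : 'I_n * 'I_n => (end_vertex t p.1 p.2 + end_vertex t p.2 p.1)%N.
have dE p : p \in enum (vertex_pairs n) ->
    degree (arr_vertices L) (arr_adj L) (vt p.1 p.2) = (4 - e p)%N.
  rewrite mem_enum inE => h; have ne : p.2 != p.1 by rewrite neq_ltn h orbT.
  by have := degree_crossing ne; rewrite -/(e p); lia.
have S : degree_sequence (arr_vertices L) (arr_adj L) =
    sort geq [seq (4 - e p)%N | p <- enum (vertex_pairs n)].
  apply/perm_sortP; try by move=> a b; apply: leq_total.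
  - by move=> a b c /= ba cb; apply: leq_trans ba.
  - by move=> a b; rewrite /= andbC -eqn_leq => /eqP.
  have := perm_map (degree (arr_vertices L) (arr_adj L)) (perm_fset_set uniq_crossings).
  rewrite -arr_vertices_crossings => /perm_trans; apply.
  have -> // : [seq (4 - e p)%N | p <- enum (vertex_pairs n)] =
      [seq degree (arr_vertices L) (arr_adj L) v | v <- crossings].
  by rewrite /crossings -map_comp; apply/eq_in_map => p /dE /= ->.
pose F := [set p in vertex_pairs n | e p == 0%N]%SET.
exists #|F|; rewrite S sort_geq_234; last first.
  by apply/allP => _ /mapP[p _ ->]; rewrite /e !inE; do 2 case: end_vertex.
rewrite !count_map !count_enum; split.
  congr (nseq _ _ ++ (nseq _ _ ++ nseq _ _)); apply: eq_card => p; rewrite !inE /= /e;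
  by do 2 case: end_vertex; rewrite ?andbF.
rewrite !card_setIdE -sum1_card -!big_split /=; apply: eq_bigr => p _; rewrite /e.
by do 2 case: end_vertex.
Qed.

End Coordinates.

(** * Zigzag arrangements of straight lines *)

(** The affine function takes an interval of values on a connected set, so it would vanish on one
    containing [u] and [v]. *)
Lemma line_separates (R : realType) (a b c : R) (l : set (plane R)) (u v : plane R) :
  (forall z, a * z.1 + b * z.2 + c = 0 -> l z) ->
  a * u.1 + b * u.2 + c < 0 -> 0 < a * v.1 + b * v.2 + c ->
  ~ connected_component (~` l) u v.
Proof.
move=> lP u0 v0 [C [Cu Cl Cc] Cv].
pose phi (z : plane R) := a * z.1 + b * z.2 + c.
have cphi : continuous phi by apply: continuous_affine => x; apply: cvg_id.
have /connected_intervalP I : connected (phi @` C).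
  exact: connected_continuous_connected (continuous_subspaceT cphi).
have [|||z Cz /lP] := I (phi u) (phi v) _ _ 0; last exact: Cl.
- by exists u.
- by exists v.
- by rewrite !ltW.
Qed.

Section StraightLines.
Variables (R : realType) (n : nat) (m b : 'I_n -> R) (t : 'I_n -> 'I_n -> R).
Hypothesis n2 : (2 < n)%N.
Hypothesis m_inj : injective m.
Hypothesis tE : forall i j, j != i -> b i + t i j * m i = b j + t i j * m j.
Hypothesis t_inj : forall i j k, j != i -> k != i -> t i j = t i k -> j = k.

Definition straight i := line_point (0, b i) (1, m i).

Lemma straightE i z : range (straight i) z <-> z.2 = b i + z.1 * m i.
Proof.
split=> [[x _ <-]|]; first by rewrite /= add0r mulr1.
by case: z => x y /= ->; exists x; rewrite // /straight /line_point /= add0r mulr1.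
Qed.

Lemma straight_param i : pseudoline_param (straight i).
Proof.
exists id, (0, b i), (1, m i); split=> //.
  by exists id; split=> // x; apply: cvg_id.
by apply/eqP => -[/eqP]; rewrite oner_eq0.
Qed.

Lemma straight_meet i j : j != i ->
  range (straight i) `&` range (straight j) = [set straight i (t i j)].
Proof.
move=> ji; have mij : m i - m j != 0 by rewrite subr_eq0; apply: contra ji => /eqP/m_inj ->.
apply/seteqP; split=> [z [/straightE zi /straightE zj]|_ ->] /=; last first.
  split; apply/straightE; rewrite /= add0r mulr1 //; exact: tE.
have E := tE ji; suff zt : z.1 = t i j.
  by rewrite [z]surjective_pairing zi zt /straight /line_point /= add0r mulr1.
apply: (mulIf mij); move: E zj; rewrite zi; lra.
Qed.

Lemma straight_coordinates : coordinates (fun i => range (straight i)) straight t.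
Proof. by split=> // [i|i j]; [exact: straight_param|exact: straight_meet]. Qed.

Lemma straight_arrangement : simple_arrangement (fun i => range (straight i)).
Proof.
split=> // [i|i j|i j k].
- by exists (straight i) => //; apply: straight_param.
- rewrite eq_sym => ji; split; first by exists (straight i (t i j)); apply: straight_meet.
  have mij : m j - m i != 0 by rewrite subr_eq0; apply: contra ji => /eqP/m_inj ->.
  have E := tE ji.
  have val x : - m i * (straight j (t i j + x)).1 + 1 * (straight j (t i j + x)).2 - b i
      = x * (m j - m i) by rewrite /= ; move: E; lra.
  (* The sign [s] directs a step along [straight j] to the positive side of [straight i]. *)
  pose s := if 0 < m j - m i then 1 else - 1 : R.
  have s0 : 0 < s * (m j - m i).
    by rewrite /s; case: (ltgtP 0 (m j - m i)) mij => // h _; [rewrite mul1r|rewrite mulN1r oppr_gt0].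
  have off x : x * (m j - m i) != 0 ->
      (range (straight j) `\` range (straight i)) (straight j (t i j + x)).
    move=> x0; split; first by exists (t i j + x).
    by move/straightE => zE; move: x0; rewrite -val zE => /eqP; apply; ring.
  exists (straight j (t i j + (- s))), (straight j (t i j + s)); split.
  + by apply: off; rewrite mulNr oppr_eq0 gt_eqF.
  + by apply: off; rewrite gt_eqF.
  apply: (@line_separates R (- m i) 1 (- b i)) => [z zE||].
  + by apply/straightE; move: zE; lra.
  + by rewrite val mulNr oppr_lt0.
  + by rewrite val.
- rewrite eq_sym => ji; rewrite eq_sym => ki; rewrite eq_sym => kj.
  rewrite -subset0 => z [[Li Lj] Lk].
  have zj : [set straight i (t i j)] z by rewrite -straight_meet.
  have zk : [set straight i (t i k)] z by rewrite -straight_meet.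
  move: zj; rewrite zk => /= -[]; rewrite !mulr1 !add0r => /t_inj.
  by rewrite ji ki => /(_ isT isT) E; rewrite E eqxx in kj.
Qed.

End StraightLines.

Section Zigzag.
Variables (R : realType) (c k : nat) (concave : bool).
Hypotheses (c0 : (0 < c)%N) (k0 : (0 < k)%N).

Definition zigzag_size := (c + k.*2)%N.
Local Notation n := zigzag_size.

(* The levels read 0 1^c 0 (1 0)^(k - 1). *)
Definition raised x := (0 < x)%N && ((x <= c)%N || ~~ odd (x - c)).

(* Distinct gaps differ by more than [n], which no bend makes up for. *)
Definition gap p : R := n%:R ^+ 3 / p%:R.

(** The chord slope [n^3 (r y - r x) / (y - x)] for the levels [r]; as subtraction truncates, the
    sum of both differences is the distance. *)
Definition jump x y : R :=
  if raised x == raised y then 0 else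
  if (x < y)%N == raised y then gap (x - y + (y - x)) else - gap (x - y + (y - x)).

Definition bend : R := if concave then - 1 else 1.

(* The slope of the chord between the points of abscissas [x] and [y]; the bend
   only breaks ties between jumps. *)
Definition zigzag_position x y := bend * (x%:R + y%:R) + jump x y.

Definition zigzag_intercept x : R := bend * x%:R ^+ 2 + n%:R ^+ 3 * (raised x)%:R.

Local Notation pos := zigzag_position.

Let n3 : (2 < n)%N. Proof. rewrite /n; lia. Qed.

Local Ltac arith := repeat match goal with
  | H : context [raised] |- _ => clear H
  | H : context [jump] |- _ => clear H
  | H : context [gap] |- _ => clear H
  | H : context [end_vertex] |- _ => clear H
  end; lia.

Lemma gap_gt p : (0 < p < n)%N -> n%:R < gap p.
Proof.
move=> /andP[p0 pn]; rewrite ltr_pdivlMr ?ltr0n // -natrM -natrX ltr_nat.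
by rewrite expnS ltn_mul2l; apply/andP; split; nia.
Qed.

(** The gaps differ by [n^3 (q - p) / (p q)], and [p q < n^2]; this is why the levels are [n^3]
    apart. *)
Lemma gap_lt p q : (0 < p)%N -> (p < q < n)%N -> gap q + n%:R < gap p.
Proof.
move=> p0 /andP[pq qn]; have q0 : (0 < q)%N by lia.
have H : (n ^ 3 * p + n * p * q < n ^ 3 * q)%N.
  have h : (p * q < n * n)%N by apply: ltn_mul => //; lia.
  apply: (@leq_trans (n ^ 3 * p.+1)); last by rewrite leq_mul2l pq orbT.
  by rewrite mulnS addnC ltn_add2r -mulnA expnS ltn_mul2l -mulnn h andbT; lia.
have [P0 Q0] : (p%:R != 0 :> R) /\ (q%:R != 0 :> R) by rewrite !pnatr_eq0 -!lt0n.
rewrite -subr_gt0.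
have -> : gap p - (gap q + n%:R) =
    (n%:R ^+ 3 * q%:R - (n%:R ^+ 3 * p%:R + n%:R * p%:R * q%:R)) / (p%:R * q%:R).
  by rewrite /gap; field; rewrite ?P0 ?Q0.
rewrite divr_gt0 ?mulr_gt0 ?ltr0n // subr_gt0.
by rewrite -!natrX -!natrM -natrD ltr_nat.
Qed.

Lemma gap_lt_add p q : (0 < p < n)%N -> (0 < q < n)%N ->
  gap p < gap q -> gap p + n%:R <= gap q.
Proof.
move=> /andP[p0 pn] /andP[q0 qn]; have [pq|qp|->] := ltngtP p q; last by rewrite ltxx.
  have := @gap_lt p q p0; rewrite pq qn => /(_ isT); have := ler0n R n; lra.
by move=> _; rewrite ltW // gap_lt // qp.
Qed.

Lemma jump_lt_add x y z : (x < n)%N -> (y < n)%N -> (z < n)%N -> y != x -> z != x ->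
  jump x y < jump x z -> jump x y + n%:R <= jump x z.
Proof.
move=> xn yn zn yx zx; rewrite /jump.
have hy : (0 < x - y + (y - x) < n)%N by lia.
have hz : (0 < x - z + (z - x) < n)%N by lia.
have := gap_gt hy; have := gap_gt hz.
have := gap_lt_add hy hz; have := gap_lt_add hz hy; have := ler0n R n.
move: (gap _) (gap _) (n%:R) => B A N N0 BA AB NB NA.
case: (raised x == raised y); case: (raised x == raised z); rewrite ?ltxx //.
- by case: (_ == raised z); lra.
- by case: (_ == raised y); lra.
by case: (_ == raised y); case: (_ == raised z) => //; lra.
Qed.

(** For fixed [x] the bend terms differ by less than [n], and distinct jumps by at least [n]. *)
Lemma position_lt x y z : (x < n)%N -> (y < n)%N -> (z < n)%N -> y != x -> z != x ->
  jump x y < jump x z -> pos x y < pos x z.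
Proof.
move=> xn yn zn yx zx /(jump_lt_add xn yn zn yx zx).
have : (y%:R < n%:R :> R) /\ (z%:R < n%:R :> R) by rewrite !ltr_nat.
by case; have := ler0n R y; have := ler0n R z; rewrite /pos /bend; case: concave; lra.
Qed.

Lemma zigzag_position_inj (x y z : 'I_n) : y != x -> z != x ->
  pos x y = pos x z -> y = z.
Proof.
move=> yx zx E; apply: val_inj.
have [h|h|] := ltgtP (jump x y) (jump x z).
- by have := position_lt (ltn_ord x) (ltn_ord y) (ltn_ord z) yx zx h; rewrite E ltxx.
- by have := position_lt (ltn_ord x) (ltn_ord z) (ltn_ord y) zx yx h; rewrite E ltxx.
move=> h; apply/eqP; rewrite -(eqr_nat R); apply/eqP.
by move: E; rewrite /pos h /bend; case: concave; lra.
Qed.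

Lemma zigzag_positionE (x y : nat) : y != x ->
  zigzag_intercept x + pos x y * - x%:R = zigzag_intercept y + pos x y * - y%:R.
Proof.
move=> yx.
have J : jump x y * (x%:R - y%:R) = n%:R ^+ 3 * ((raised x)%:R - (raised y)%:R).
  rewrite /jump; have [->|ne] := eqVneq (raised x) (raised y); first by ring.
  have [h|h|h] := ltngtP x y; last by rewrite h eqxx in yx.
    have -> : (x - y + (y - x) = y - x)%N by lia.
    have D : (y%:R - x%:R != 0 :> R) by rewrite subr_eq0 eqr_nat; lia.
    rewrite /gap natrB ?(ltnW h) //.
    by case: (raised x) (raised y) ne => -[] //= _; field.
  have -> : (x - y + (y - x) = x - y)%N by lia.
  have D : (x%:R - y%:R != 0 :> R) by rewrite subr_eq0 eqr_nat; lia.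
  rewrite /gap natrB ?(ltnW h) //.
  by case: (raised x) (raised y) ne => -[] //= _; field.
apply/eqP; rewrite -subr_eq0; apply/eqP; rewrite /zigzag_intercept /pos.
transitivity (n%:R ^+ 3 * ((raised x)%:R - (raised y)%:R) - jump x y * (x%:R - y%:R)); first by ring.
by rewrite J subrr.
Qed.

Lemma jumpC x y : jump x y = jump y x.
Proof.
rewrite /jump eq_sym addnC; case: eqVneq => // ne.
by case: (ltngtP x y) => [h|h|h]; [| |by rewrite h eqxx in ne]; case: (raised x) (raised y) ne => -[].
Qed.

Lemma jump0 x y : raised x = raised y -> jump x y = 0.
Proof. by move=> E; rewrite /jump E eqxx. Qed.

Lemma jump_up x y : (x < y)%N -> ~~ raised x -> raised y -> jump x y = gap (y - x).
Proof.
move=> xy /negbTE rx ry; rewrite /jump rx ry xy /=.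
by congr gap; lia.
Qed.

Lemma jump_down x y : (x < y)%N -> raised x -> ~~ raised y -> jump x y = - gap (y - x).
Proof.
move=> xy rx /negbTE ry; rewrite /jump rx ry xy /=.
by congr (- gap _); lia.
Qed.

Lemma gap_gt0 p : (0 < p < n)%N -> 0 < gap p.
Proof. by move/gap_gt; apply: le_lt_trans; rewrite ler0n. Qed.

Lemma gap_anti p q : (0 < p)%N -> (p < q < n)%N -> gap q < gap p.
Proof. by move=> p0 /(gap_lt p0); apply: le_lt_trans; rewrite lerDl ler0n. Qed.

Definition zigzag (x y : 'I_n) : R := pos x y.

Lemma not_end_vertex (x y : 'I_n) (u v : nat) : (u < n)%N -> (v < n)%N ->
  u != x -> v != x -> pos x u < pos x y -> pos x y < pos x v ->
  end_vertex zigzag x y = false.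
Proof.
move=> un vn ux vx uy yv; apply/negbTE/negP => /orP[]/extremeP[yx].
  move/(_ (Ordinal vn) vx); rewrite /zigzag /= => H.
  have [e|ne] := eqVneq (Ordinal vn) y; first by rewrite -e /= ltxx in yv.
  by have := H ne; rewrite ltNge ltW.
move/(_ (Ordinal un) ux); rewrite /zigzag /= => H.
have [e|ne] := eqVneq (Ordinal un) y; first by rewrite -e /= ltxx in uy.
by have := H ne; rewrite ltNge ltW.
Qed.

Lemma not_end_vertex_jump (x y : 'I_n) (u v : nat) : (u < n)%N -> (v < n)%N ->
  y != x -> u != x -> v != x -> jump x u < jump x y -> jump x y < jump x v ->
  end_vertex zigzag x y = false.
Proof.
move=> un vn yx ux vx uy yv.
by apply: (not_end_vertex un vn ux vx); apply: position_lt.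
Qed.

Lemma end_vertex_jump_max (x y : 'I_n) : y != x ->
  (forall z : nat, (z < n)%N -> z != x -> z != y -> jump x z < jump x y) ->
  end_vertex zigzag x y.
Proof.
move=> yx H; apply/orP; left; apply/extremeP; split=> // z zx zy.
by apply: position_lt => //; apply: H.
Qed.

Lemma end_vertex_jump_min (x y : 'I_n) : y != x ->
  (forall z : nat, (z < n)%N -> z != x -> z != y -> jump x y < jump x z) ->
  end_vertex zigzag x y.
Proof.
move=> yx H; apply/orP; right; apply/extremeP; split=> // z zx zy.
by apply: position_lt => //; apply: H.
Qed.

Lemma raised_ends : [/\ ~~ raised 0, raised 1, raised n.-2 & ~~ raised n.-1].
Proof. by rewrite /raised /n; split; lia. Qed.

Lemma raised_step x : (x < n.-1)%N ->
  (raised x != raised x.+1) = (x == 0%N) || (c <= x)%N.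
Proof. by rewrite /raised /n => xn; lia. Qed.

(** A unit chord between different levels is the steepest of its sign: any other jump at [x] or [y]
    has a smaller gap, is zero or has the opposite sign. *)
Lemma zigzag_adjacent (x y : 'I_n) : y = x.+1 :> nat -> raised x != raised y ->
  end_vertex zigzag x y && end_vertex zigzag y x.
Proof.
move=> yE ne; have yn := ltn_ord y; have xn := ltn_ord x.
have yx : y != x by rewrite -val_eqE /= yE; arith.
have xy : x != y by rewrite eq_sym.
case rx : (raised x) ne; case ry : (raised y) => // _.
- have J : jump x y = - gap 1 by rewrite jump_down ?yE ?subSnn ?rx -?yE ?ry.
  have g1 : 0 < gap 1 by apply: gap_gt0; arith.
  rewrite !end_vertex_jump_min // => z zn zx zy; [rewrite (jumpC y x)|]; rewrite J.
    case rz : (raised z); last by rewrite jump0 ?ry ?rz // oppr_lt0.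
    have [h|h|h] := ltngtP z y; last by rewrite h eqxx in zx.
      rewrite jumpC jump_down ?rz ?ry // ltrN2 gap_anti //; arith.
    by rewrite jump_up ?rz ?ry //; have : 0 < gap (z - y) by [apply: gap_gt0; arith]; lra.
  case rz : (raised z); first by rewrite jump0 ?rx ?rz // oppr_lt0.
  have [h|h|h] := ltngtP z x; last by rewrite h eqxx in zx.
    by rewrite jumpC jump_up ?rz ?rx //; have : 0 < gap (x - z) by [apply: gap_gt0; arith]; lra.
  by rewrite jump_down ?rz ?rx // ltrN2 gap_anti //; arith.
- have J : jump x y = gap 1 by rewrite jump_up ?yE ?subSnn ?rx -?yE ?ry.
  have g1 : 0 < gap 1 by apply: gap_gt0; arith.
  rewrite !end_vertex_jump_max // => z zn zx zy; [rewrite (jumpC y x)|]; rewrite J.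
    case rz : (raised z); first by rewrite jump0 ?ry ?rz.
    have [h|h|h] := ltngtP z y; last by rewrite h eqxx in zx.
      rewrite jumpC jump_up ?rz ?ry // gap_anti //; arith.
    by rewrite jump_down ?rz ?ry //; have : 0 < gap (z - y) by [apply: gap_gt0; arith]; lra.
  case rz : (raised z); last by rewrite jump0 ?rx ?rz.
  have [h|h|h] := ltngtP z x; last by rewrite h eqxx in zx.
    by rewrite jumpC jump_down ?rz ?rx //; have : 0 < gap (x - z) by [apply: gap_gt0; arith]; lra.
  by rewrite jump_up ?rz ?rx // gap_anti //; arith.
Qed.

Hypothesis k1 : ~~ concave -> (1 < k)%N.

(** At [0] no jump is negative and at [n - 1] none is positive, so this level chord competes only
    with level chords, and concavity makes it extreme. In the convex case an inner low point beats
    it; [1 < k] supplies one. *)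
Lemma zigzag_outer (x y : 'I_n) : x = 0%N :> nat -> y = n.-1 :> nat ->
  end_vertex zigzag x y && end_vertex zigzag y x = concave.
Proof.
move=> xE yE; have [r0 r1 _ rn] := raised_ends; have yn := ltn_ord y.
have yx : y != x by rewrite -val_eqE /= xE yE; arith.
have xy : x != y by rewrite eq_sym.
have ry : raised y = false by rewrite yE (negbTE rn).
have rx : raised x = false by rewrite xE (negbTE r0).
have P a b : raised a = raised b -> pos a b = bend * (a%:R + b%:R).
  by move=> /jump0 E; rewrite /pos E addr0.
have [cv|cv] := boolP concave.
  apply/andP; split; apply/orP; [right|left]; apply/extremeP; split=> // z zx zy /=.
    case rz : (raised z).
      apply: position_lt => //; rewrite jump0 ?rx ?ry // jump_up ?rx ?rz //.
        by apply: gap_gt0; have := ltn_ord z; rewrite xE; have := zx; rewrite -val_eqE /= xE; arith.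
      by have := zx; rewrite -val_eqE /= xE; arith.
    rewrite /zigzag !P ?rx ?ry ?rz // /bend cv !mulN1r ltrN2 ltrD2l ltr_nat.
    by have := zy; have := ltn_ord z; rewrite -val_eqE /= yE; arith.
  case rz : (raised z).
    apply: position_lt => //; rewrite (@jump0 y x) ?rx ?ry // jumpC jump_down ?ry ?rz //.
      by rewrite oppr_lt0; apply: gap_gt0; have := ltn_ord z; have := zx; rewrite -val_eqE /= yE; arith.
    by have := ltn_ord z; have := zx; rewrite -val_eqE /= yE; arith.
  rewrite /zigzag !P ?rx ?ry ?rz // /bend cv !mulN1r ltrN2 ltrD2l ltr_nat.
  by have := zy; rewrite -val_eqE /= xE; arith.
have k2 := k1 cv.
(* The low point [c + 1] gives a smaller slope and the raised point [1] a larger one. *)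
rewrite (@not_end_vertex x y c.+1 1%N) //; try (rewrite /n ?xE; arith).
- have rc : raised c.+1 = false by rewrite /raised; move: c0; clear; lia.
  by rewrite !P ?rx ?ry ?rc // /bend (negbTE cv) !mul1r ltrD2l ltr_nat yE /n; arith.
- apply: position_lt => //; try (rewrite /n ?xE; arith).
  rewrite jump0 ?rx ?ry // jump_up ?rx ?xE //; apply: gap_gt0; rewrite /n; arith.
Qed.

(** One of the two lines has crossings on both sides of this one. For different levels, [x + 1]
    gives a steeper chord of the same sign, taken from [x] or [y] according to its level, and [0] or
    [n - 1] bounds the other side. *)
Lemma zigzag_other (x y : 'I_n) : (x < y)%N ->
  ~~ ((y == x.+1 :> nat) && (raised x != raised y)) ->
  ~~ ((x == 0%N :> nat) && (y == n.-1 :> nat)) ->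
  end_vertex zigzag x y && end_vertex zigzag y x = false.
Proof.
move=> xy nadj nout; have [r0 r1 rn2 rn1] := raised_ends; have yn := ltn_ord y.
have yx : y != x by rewrite neq_ltn xy orbT.
have xy' : x != y by rewrite eq_sym.
have p0 a : raised a -> (0 < a)%N by case: a => //; rewrite (negbTE r0).
have p1 a : raised a -> (a < n)%N -> (a < n.-1)%N.
  by move=> ra an; have : a != n.-1 by [apply: contraTneq ra => ->]; arith.
have q0 a : raised a = false -> (0 < a)%N -> (1 < a)%N.
  by move=> ra a0; have : a != 1%N by [apply: contraFneq ra => ->]; arith.
have q1 a : raised a = false -> (a < n.-1)%N -> (a < n.-2)%N.
  by move=> ra an; have : a != n.-2 by [apply: contraFneq ra => ->]; arith.
have up a b : (a < b)%N -> (b < n)%N -> ~~ raised a -> raised b ->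
    0 < jump a b /\ 0 < jump b a.
  by move=> ab bn ra rb; rewrite (jumpC b) jump_up //; split; apply: gap_gt0; arith.
have dn a b : (a < b)%N -> (b < n)%N -> raised a -> ~~ raised b ->
    jump a b < 0 /\ jump b a < 0.
  by move=> ab bn ra rb; rewrite (jumpC b) jump_down // oppr_lt0; split; apply: gap_gt0; arith.
have NE (a b : 'I_n) u v : b != a -> [&& u < n, v < n, u != a & v != a]%N ->
    jump a u < jump a b -> jump a b < jump a v -> end_vertex zigzag a b = false.
  by move=> ba /and4P[? ? ? ?]; apply: not_end_vertex_jump.
case rx : (raised x); case ry : (raised y).
- have x0 := p0 _ rx; have x1 := p1 _ rx (ltn_ord x).
  rewrite (@NE x y n.-1 0%N) // ?(jump0 (x := x) (y := y)) ?rx ?ry //; first arith.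
    by apply: (dn _ _ _ _ _ _).1; rewrite ?rx //; arith.
  by apply: (up _ _ _ _ _ _).2; rewrite ?rx //; arith.
- have adj : y != x.+1 :> nat by move: nadj; rewrite rx ry andbT.
  have J : jump x y = - gap (y - x) by rewrite jump_down ?rx ?ry.
  have x0 := p0 _ rx; have [rk|rk] := boolP (raised x.+1).
    rewrite [X in _ && X](@NE y x x.+1 0%N) ?andbF //; first arith.
      rewrite !(jumpC y) J jump_down ?ry //; last arith.
      rewrite ltrN2 gap_anti //; arith.
    rewrite (jumpC y x) J jump0 ?ry ?(negbTE r0) // oppr_lt0; apply: gap_gt0; arith.
  rewrite (@NE x y x.+1 0%N) //; first arith.
    rewrite jump_down ?rx // J ltrN2 gap_anti //; arith.
  apply: (@lt_trans _ _ 0); first by apply: (dn _ _ _ _ _ _).1; rewrite ?rx ?ry.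
  by apply: (up _ _ _ _ _ _).2; rewrite ?rx.
- have adj : y != x.+1 :> nat by move: nadj; rewrite rx ry andbT.
  have J : jump x y = gap (y - x) by rewrite jump_up ?rx ?ry.
  have y1 := p1 _ ry yn; have [rk|rk] := boolP (raised x.+1).
    rewrite (@NE x y n.-1 x.+1) //; first arith.
      rewrite J jump0 ?rx ?(negbTE rn1) //; apply: gap_gt0; arith.
    rewrite J jump_up ?rx // gap_anti //; arith.
  rewrite [X in _ && X](@NE y x n.-1 x.+1) ?andbF //; first arith.
    apply: (@lt_trans _ _ 0); first by apply: (dn _ _ _ _ _ _).1; rewrite ?ry //; arith.
    by apply: (up _ _ _ _ _ _).2; rewrite ?rx ?ry.
  rewrite !(jumpC y) J jump_up ?ry //; last arith.
  rewrite gap_anti //; arith.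
(* For two low points, one that is not outermost sees the raised points [1] and [n - 2] with
   opposite signs. *)
- have [x0|x0] := posnP x.
    have y1 : (y < n.-1)%N by move: nout; rewrite x0 eqxx /=; arith.
    rewrite [X in _ && X](@NE y x 1%N n.-2) ?andbF // ?(jump0 (x := y) (y := x)) ?rx ?ry //.
    + have := q0 _ ry; have := q1 _ ry y1; arith.
    + by apply: (dn _ _ _ _ _ _).2; rewrite ?ry // q0 //; arith.
    + by apply: (up _ _ _ _ _ _).1; rewrite ?ry // ?q1 //; arith.
  have xn1 : (x < n.-1)%N by arith.
  rewrite (@NE x y 1%N n.-2) // ?(jump0 (x := x) (y := y)) ?rx ?ry //.
  + have := q0 _ rx x0; have := q1 _ rx xn1; arith.
  + by apply: (dn _ _ _ _ _ _).2; rewrite ?rx // q0.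
  + by apply: (up _ _ _ _ _ _).1; rewrite ?rx // ?q1 //; arith.
Qed.

Definition zigzag_wedges : seq (nat * nat) :=
  [seq (x, x.+1) | x <- 0%N :: iota c (n.-1 - c)] ++
  (if concave then [:: (0, n.-1)] else [::])%N.

Lemma card_zigzag_wedges : #|wedges zigzag| = (k.*2 + concave)%N.
Proof.
have <- : size zigzag_wedges = (k.*2 + concave)%N.
  rewrite size_cat size_map /= size_iota /n; case: concave => /=; lia.
rewrite cardE -(size_map (fun p : 'I_n * 'I_n => (nat_of_ord p.1, nat_of_ord p.2))).
apply/perm_size/uniq_perm.
- rewrite map_inj_uniq ?enum_uniq // => -[a b] [a' b'] [] /val_inj -> /val_inj -> //.
- rewrite cat_uniq; apply/and3P; split; last by case: concave.
    by rewrite map_inj_uniq => [|a b []//]; rewrite /= iota_uniq mem_iota leqNgt c0.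
  apply/hasPn => p ps; apply/negP => /mapP[x _ pE]; move: ps; rewrite pE.
  by case: concave => //; rewrite inE => /eqP[->]; move: n3; clear; lia.
move=> [a b]; apply/mapP/idP.
  case=> -[x y]; rewrite mem_enum => /setIdP[]; rewrite inE => xy W [-> ->].
  rewrite /zigzag_wedges mem_cat; apply/orP.
  have [/andP[/eqP yE ne]|nadj] := boolP ((y == x.+1 :> nat) && (raised x != raised y)).
    left; apply/mapP; exists (nat_of_ord x); last by rewrite yE.
    have := ltn_ord y; rewrite inE mem_iota yE => h; rewrite yE in ne.
    by move: ne; rewrite raised_step; lia.
  have [/andP[/eqP xE /eqP yE]|nout] := boolP ((x == 0%N :> nat) && (y == n.-1 :> nat)).
    by right; move: W; rewrite (zigzag_outer xE yE) => ->; rewrite xE yE inE.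
  by move: W; rewrite zigzag_other.
rewrite /zigzag_wedges mem_cat => /orP[/mapP[x]|].
  rewrite inE mem_iota => xP [-> ->].
  have xn : (x.+1 < n)%N by move: xP; rewrite /n; lia.
  exists (Ordinal (ltnW xn), Ordinal xn) => //.
  rewrite mem_enum !inE /= ltnSn /=; apply: zigzag_adjacent => //=.
  by rewrite raised_step; lia.
case: (boolP concave) => // cv; rewrite inE => /eqP[-> ->].
have h0 : (0 < n)%N by lia.
have h1 : (n.-1 < n)%N by lia.
exists (Ordinal h0, Ordinal h1) => //.
rewrite mem_enum !inE /= zigzag_outer // cv andbT; lia.
Qed.

End Zigzag.

(** * Assembling the characterization *)

Lemma vertex_count (n d2 d4 : nat) :
  (d4%:R = n%:R * (n%:R - 5%:R) / 2%:R + d2%:R :> rat) <->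
  (d4.*2 + 5 * n = n * n + d2.*2)%N.
Proof.
have E : (d4.*2 + 5 * n)%:R - (n * n + d2.*2)%:R =
    2 * (d4%:R - (n%:R * (n%:R - 5%:R) / 2%:R + d2%:R)) :> rat.
  by rewrite !natrD !natrM -!muln2 !natrM; field.
split=> [H|H]; last by move: E; rewrite H subrr; lra.
by apply/eqP; rewrite -(eqr_nat rat) -subr_eq0 E H subrr mulr0.
Qed.

Theorem theorem1 (R : realType) (s : seq nat)
    (s_pos : forall x : nat, x \in s -> (0 < x)%N)
    (s_noninc : sorted geq s) :
  is_arrangement_degree_sequence R s <->
  exists n d2 d3 d4 : nat,
    [/\ (3 <= n)%N,
        s = nseq d4 4%N ++ nseq d3 3%N ++ nseq d2 2%N,
        (3 <= d2 <= n)%N,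
        d3 = (2 * (n - d2))%N &
        (d4%:R = n%:R * (n%:R - 5%:R) / 2%:R + d2%:R :> rat)%R]
    /\ (d2 = n -> odd n).
Proof.
split.
  move=> [n [L [LA <-]]]; have n2 : (2 < n)%N by case: LA.
  have [g [t gtP]] := coordinates_ex LA; have [chi sgC] := sides_ex LA gtP.
  have t_inj := position_inj LA gtP.
  have [d4 [-> D]] := degree_sequenceE LA gtP.
  have W3 := wedges_ge3 t_inj sgC n2; have odd_n := card_wedges_eq_odd t_inj sgC n2.
  have H := card_half_wedges t_inj n2; have P := card_vertex_pairs n.
  exists n, #|wedges t|, #|half_wedges t|, d4; split=> //; split=> //; try lia.
  by apply/vertex_count; lia.
move=> [n [d2 [d3 [d4 [[n3 -> /andP[d2_ge d2_le] d3E /vertex_count d4E] odd_n]]]]].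
(* Level changes yield [2k] wedges, and a concave bend, used when [d2] is odd, adds one more: [d2]
   in all. *)
pose k := d2./2; pose c := (n - k.*2)%N.
(* Here the parity condition enters: if [d2 = n], then [n] is odd and [2k < n]. *)
have c0 : (0 < c)%N.
  have : d2 != n \/ odd n by have [e|] := eqVneq d2 n; [right; apply: odd_n|left].
  rewrite /c /k; case; lia.
have k0 : (0 < k)%N by rewrite /k; lia.
have k1 : ~~ odd d2 -> (1 < k)%N by rewrite /k; lia.
have nE : zigzag_size c k = n by rewrite /zigzag_size /c /k; lia.
have n2 : (2 < zigzag_size c k)%N by rewrite nE.
pose m (i : 'I_(zigzag_size c k)) : R := - (i : nat)%:R.
pose b (i : 'I_(zigzag_size c k)) : R := zigzag_intercept R c k (odd d2) i.
have m_inj : injective m.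
  by move=> i j /oppr_inj/eqP; rewrite eqr_nat => /eqP/val_inj.
have tE i j : j != i ->
    b i + zigzag R (odd d2) i j * m i = b j + zigzag R (odd d2) i j * m j.
  exact: zigzag_positionE.
have t_inj (i j l : 'I_(zigzag_size c k)) : j != i -> l != i ->
    zigzag R (odd d2) i j = zigzag R (odd d2) i l -> j = l.
  exact: zigzag_position_inj.
have LA := straight_arrangement n2 m_inj tE t_inj.
exists (zigzag_size c k), (fun i => range (straight m b i)); split=> //.
have [d4' [-> D]] := degree_sequenceE LA (straight_coordinates m_inj tE).
have W : #|wedges (zigzag (c := c) (k := k) R (odd d2))| = d2.
  by rewrite card_zigzag_wedges // /k; lia.
have := card_half_wedges t_inj n2; have := card_vertex_pairs (zigzag_size c k).
move: D; rewrite W; move: #|half_wedges _| => h; rewrite nE => D P H.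
by congr (nseq _ _ ++ (nseq _ _ ++ _)); lia.
Qed.
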